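(* There exist absolute constants $C_1, C_2 > 0$ (independent of $m$, $n$, $A$, $Z$ and ${\bf u}$) such that the following holds. Let $m \ge n \ge 1$, let $A \in \mathbb{R}^{m\times m}$ be symmetric positive definite and let $Z \in \mathbb{R}^{m \times n}$ have full column rank. Let $\widehat Q = [\widehat{\boldsymbol q}_1,\dots,\widehat{\boldsymbol q}_n]$, $\widehat R$ and $\widehat{\boldsymbol z}_j^{(i-1)}$ ($1\le i \le j\le n$) be the quantities computed by the algorithm MGS-HA(col), applied to $Z$ and $A$ in floating-point arithmetic with unit rounding error ${\bf u}$. If $$C_2\, m^{3/2}\,{\bf u}\,\kappa(A)\,\kappa(A^{1/2}Z) < 1,$$ then, with $$\mu := \max_{1\le i\le j\le n}\frac{\|\widehat{\boldsymbol z}_j^{(i-1)}\|}{\|\widehat{\boldsymbol z}_j^{(i-1)}\|_A},$$ the loss of $A$-orthogonality satisfies $$\|\widehat Q^{\rm T} A \widehat Q - I_n\| \le \frac{C_1 m^{3/2}\,{\bf u}\,\|A\|\,\|\widehat Q\|\,\mu\,\kappa(A^{1/2}Z)}{1 - C_1 m^{3/2}\,{\bf u}\,\|A\|\,\|\widehat Q\|\,\mu\,\kappa(A^{1/2}Z)} \le \frac{C_2 m^{3/2}\,{\bf u}\,\kappa(A)\,\kappa(A^{1/2}Z)}{1 - C_2 m^{3/2}\,{\bf u}\,\kappa(A)\,\kappa(A^{1/2}Z)}.$$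
   Context: Norms without subscript are 2-norms (spectral norm for matrices). For an spd matrix $A$, $\|\boldsymbol x\|_A := \sqrt{\boldsymbol x^{\rm T}A\boldsymbol x}$. For a matrix $M$ of full column rank, $\kappa(M)$ is the ratio of its largest to its smallest singular value. $A^{1/2}$ is the spd square root of $A$. Algorithm MGS-HA(col) (high accuracy implementation of column-oriented modified Gram-Schmidt). Input: $Z=[\boldsymbol z_1^{(0)},\dots,\boldsymbol z_n^{(0)}]$ and $A$. For $j=1,\dots,n$ do: (1) for $i=1,\dots,j-1$: $r_{ij} = \boldsymbol p_i^{\rm T}\boldsymbol z_j^{(i-1)}$, then $\boldsymbol z_j^{(i)} = \boldsymbol z_j^{(i-1)} - r_{ij}\boldsymbol q_i$; (2) $\boldsymbol x_j^{(j-1)} = A\boldsymbol z_j^{(j-1)}$; (3) $r_{jj} = \sqrt{(\boldsymbol z_j^{(j-1)})^{\rm T}\boldsymbol x_j^{(j-1)}}$; (4) $\boldsymbol q_j = \boldsymbol z_j^{(j-1)}/r_{jj}$; (5) $\boldsymbol p_j = \boldsymbol x_j^{(j-1)}/r_{jj}$. Output: $Q=[\boldsymbol q_1,\dots,\boldsymbol q_n]$ and the upper triangular $R=(r_{ij})\in\mathbb{R}^{n\times n}$ ($r_{ij}=0$ for $i>j$). Hats denote the quantities actually computed in floating-point arithmetic. Floating-point model: the standard model, in which each elementary operation $+,-,\times,/,\sqrt{\ }$ is performed with relative error at most ${\bf u}$, without overflow or underflow. In particular, with $\gamma_m := m{\bf u}/(1-m{\bf u})$ (assuming $m{\bf u}<1$)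 and absolute values and inequalities taken entrywise: scaling $\boldsymbol y=\alpha\boldsymbol x$ is computed as $\widehat{\boldsymbol y}=\alpha\boldsymbol x+\Delta\boldsymbol y$ with $|\Delta\boldsymbol y|\le{\bf u}|\alpha||\boldsymbol x|$; an inner product $\alpha=\boldsymbol x^{\rm T}\boldsymbol y$ of vectors in $\mathbb{R}^m$ as $\widehat\alpha=\boldsymbol x^{\rm T}\boldsymbol y+\Delta\alpha$ with $|\Delta\alpha|\le\gamma_m|\boldsymbol x|^{\rm T}|\boldsymbol y|$; a product $\boldsymbol y=A\boldsymbol x$ with $A\in\mathbb{R}^{m\times m}$ as $\widehat{\boldsymbol y}=A\boldsymbol x+\Delta\boldsymbol y$ with $|\Delta\boldsymbol y|\le\gamma_m|A||\boldsymbol x|$. The entries of $A$ and $Z$ are taken as exact floating-point data.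
   Formalization: The formal theorem assumes that all inner products in a run are summed in one fixed (arbitrary) order, and all rows of products by A in one fixed order; with only the entrywise γ_m bounds, or freely varying orders, the m^{3/2} bound fails (A = I, Z a scaled Hadamard matrix). *)

(* Defs.v *)
From HB Require Import structures.
From mathcomp Require Import all_boot all_order all_algebra.
From mathcomp Require Import all_classical all_reals.

Set Implicit Arguments.
Unset Strict Implicit.
Unset Printing Implicit Defensive.
Import Order.TTheory GRing.Theory Num.Theory.
Local Open Scope classical_set_scope.
Local Open Scope ring_scope.

Section LinearAlgebra.
Variable R : realType.

Definition dot (m : nat) (x y : 'cV[R]_m) : R := \sum_(k < m) x k 0 * y k 0.

Definition norm2 (m : nat) (x : 'cV[R]_m) : R := Num.sqrt (dot x x).

Definition normA (m : nat) (A : 'M[R]_m) (x : 'cV[R]_m) : R :=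
  Num.sqrt (dot x (A *m x)).

(* Spectral norm, as the matrix norm induced by the Euclidean norm. *)
Definition specnorm (m n : nat) (M : 'M[R]_(m, n)) : R :=
  sup [set norm2 (M *m x) | x in [set x : 'cV[R]_n | norm2 x = 1]].

Definition spd (m : nat) (A : 'M[R]_m) : Prop :=
  A^T = A /\ forall x : 'cV[R]_m, x != 0 -> 0 < dot x (A *m x).

Definition spd_sqrt (m : nat) (A B : 'M[R]_m) : Prop :=
  spd B /\ B *m B = A.

(* For m >= n these are exactly the n singular values of M. *)
Definition singular_values (m n : nat) (M : 'M[R]_(m, n)) : set R :=
  [set s : R | 0 <= s /\ eigenvalue (M^T *m M) (s ^+ 2)].

(* The set of singular values is finite and nonempty when 1 <= n, so the sup
   and the inf are its largest and smallest elements. *)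
Definition kappa (m n : nat) (M : 'M[R]_(m, n)) : R :=
  sup (singular_values M) / inf (singular_values M).

End LinearAlgebra.

(* A bracketing of a sum: [Add l r] adds the values of the partial sums l and
   r. Left-to-right summation is Add (.. (Add (Term 0) (Term 1)) ..). *)
Inductive sum_order (I : Type) : Type :=
| Term of I
| Add of sum_order I & sum_order I.

Fixpoint terms (I : Type) (t : sum_order I) : seq I :=
  match t with
  | Term i => [:: i]
  | Add l r => terms l ++ terms r
  end.

(* Every index 0, ..., m-1 is summed exactly once. *)
Definition complete_order (m : nat) (t : sum_order 'I_m) : Prop :=
  perm_eq (terms t) (enum 'I_m).

Section FloatingPoint.
Variables (R : realType) (u : R).

(* Standard model of rounding: c is a possible computed value of an elementary
   operation whose exact result on the same operands is e. *)
Definition rounds (e c : R) : Prop :=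
  exists2 delta : R, `|delta| <= u & c = e * (1 + delta).

(* [fl_sum t x y s]: s is a possible computed value of the sum of the products
   x k * y k, bracketed as prescribed by t. One error is made per product and
   one per addition. *)
Fixpoint fl_sum (I : Type) (t : sum_order I) (x y : I -> R) (s : R) : Prop :=
  match t with
  | Term k => rounds (x k * y k) s
  | Add l r => exists a b : R,
      [/\ fl_sum l x y a, fl_sum r x y b & rounds (a + b) s]
  end.

Definition fl_dot (m : nat) (t : sum_order 'I_m) (x y : 'cV[R]_m) (s : R)
    : Prop :=
  fl_sum t (fun k => x k 0) (fun k => y k 0) s.

Definition fl_mulmx (m : nat) (t : sum_order 'I_m) (A : 'M[R]_m)
    (x y : 'cV[R]_m) : Prop :=
  forall k : 'I_m, fl_sum t (fun l => A k l) (fun l => x l 0) (y k 0).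

(* y is a possible computed value of z - r q. *)
Definition fl_update (m : nat) (z : 'cV[R]_m) (r : R) (q y : 'cV[R]_m)
    : Prop :=
  forall k : 'I_m, exists2 c : R,
    rounds (r * q k 0) c & rounds (z k 0 - c) (y k 0).

(* y is a possible computed value of x / r. *)
Definition fl_divide (m : nat) (x : 'cV[R]_m) (r : R) (y : 'cV[R]_m) : Prop :=
  forall k : 'I_m, rounds (x k 0 / r) (y k 0).

(* The quantities computed by MGS-HA(col) in floating-point arithmetic.
   Columns are numbered from 0, so for j : 'I_n the vector z j i (i <= j) is
   column j after i projection steps: z j 0 is the input column, and z j j the
   vector that gets normalized.
   td is the order of summation of inner products, and tm that of the rows of
   a product by A; each is the same throughout a run.
   Absence of breakdown is not required: Num.sqrt is 0 on negative numbers and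
   a / 0 = 0. *)
Record mgs_ha_col (m n : nat) (td tm : sum_order 'I_m)
    (A : 'M[R]_m) (Z : 'M[R]_(m, n))
    (z : 'I_n -> nat -> 'cV[R]_m) (X P Q : 'M[R]_(m, n)) (Rh : 'M[R]_n)
    : Prop := MgsHaCol {
  mgs_init : forall j : 'I_n, z j 0%N = col j Z;
  mgs_offdiag : forall i j : 'I_n, (i < j)%N ->
    fl_dot td (col i P) (z j i) (Rh i j);
  mgs_update : forall i j : 'I_n, (i < j)%N ->
    fl_update (z j i) (Rh i j) (col i Q) (z j i.+1);
  mgs_mulA : forall j : 'I_n, fl_mulmx tm A (z j j) (col j X);
  mgs_diag : forall j : 'I_n, exists2 s : R,
    fl_dot td (z j j) (col j X) s & rounds (Num.sqrt s) (Rh j j);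
  mgs_q : forall j : 'I_n, fl_divide (z j j) (Rh j j) (col j Q);
  mgs_p : forall j : 'I_n, fl_divide (col j X) (Rh j j) (col j P);
  mgs_lower : forall i j : 'I_n, (j < i)%N -> Rh i j = 0
}.

End FloatingPoint.

(* The ratios are nonnegative, so starting the maximum at 0 is harmless. *)
Definition mgs_mu (R : realType) (m n : nat) (A : 'M[R]_m)
    (z : 'I_n -> nat -> 'cV[R]_m) : R :=
  \big[Num.max/0]_(j < n) \big[Num.max/0]_(i < j.+1)
    (norm2 (z j i) / normA A (z j i)).

(* Main.v *)
Require Import Defs.
From mathcomp Require Import all_boot all_order all_algebra.
From mathcomp Require Import all_classical all_reals exp.
From mathcomp Require Import ring lra.
Import Order.TTheory GRing.Theory Num.Theory.
Local Open Scope ring_scope.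

Set Implicit Arguments.
Unset Strict Implicit.
Unset Printing Implicit Defensive.

(** The bound with [m `^ (3/2)] needs more than the entrywise estimates of the
    rounding errors, which lose a factor [sqrt m] when they are assembled into
    matrices. Two observations recover it.

    First, to leading order the error of a computed inner product is a sum, over
    the nodes of its summation tree, of [u] times the exact partial sum at that
    node. As all inner products use the same tree, for each node the partial
    sums [p_i^T z_j^(i-1)] form the matrix [triu (P_B^T Q_B) R], where [B] is
    the set of summed rows; its Frobenius norm is at most
    [sqrt n * (max_i |q_i|) * ||P|| * ||R||].

    Second, put [z_j^(i) = 0] for [i >= j], so that all columns undergo the same
    recurrence [z^(i) = z^(i-1) - r_i q_i + delta_i], with
    [r_i = q_i^T A z^(i-1) + eps_i]. The recurrence then holds for every linear
    combination [v] of the columns, and since [q_i] is nearly of unit length,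
    [|z^(i)|_A^2 = |z^(i-1)|_A^2 - r_i^2 + 2 r_i eps_i + ...]; summing over [i]
    compares [|R v|] with [|Z v|_A] from above and from below. This bounds [R]
    and its inverse without any a priori knowledge on the orthogonality of [Q],
    and excludes a breakdown.

    Finally [(triu (Q^T A Q) - I) R] is the matrix of the errors
    [- eps_ij + q_i^T A (sum_(l >= i) delta_lj)], of Frobenius norm
    [O (m^(3/2) u ||A|| ||Q|| mu ||A^(1/2) Z||)], and it remains to multiply by
    the inverse of [R]. The bound [||Q|| = O (||A^(-1)||^(1/2))] used on the way
    comes by induction on the number of columns. *)

(* Hides from [lra] everything but the listed hypotheses, so that it stays fast in large
   contexts. *)
Local Tactic Notation "lra_using" ne_hyp_list(hs) := clear - hs; lra.

(** * Euclidean and operator norms *)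

Section EuclideanNorm.
Variable R : realType.

(** A quadratic that is nowhere negative has a nonpositive discriminant; this is the source of the
    three Cauchy-Schwarz inequalities below. *)
Lemma quad_disc (a b c : R) :
  0 <= a -> (forall t, 0 <= a * t ^+ 2 + 2 * b * t + c) -> b ^+ 2 <= a * c.
Proof.
move=> a_ge0 pos.
have [a0|a_neq0] := eqVneq a 0.
  suff -> : b = 0 by rewrite a0 expr0n mul0r.
  apply/eqP; apply: contraT => b_neq0.
  (* For [a = 0] the affine function [2 * b * t + c] takes the value -1 at this point. *)
  have := pos (- (c + 1) / (2 * b)).
  have -> : a * (- (c + 1) / (2 * b)) ^+ 2 + 2 * b * (- (c + 1) / (2 * b)) + c
            = -1 by rewrite a0; field.
  lra.
have a_gt0 : 0 < a by rewrite lt_def a_neq0.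
have := pos (- b / a).
have -> : a * (- b / a) ^+ 2 + 2 * b * (- b / a) + c = c - b ^+ 2 / a by field.
by rewrite subr_ge0 ler_pdivrMr // mulrC.
Qed.

Lemma ler_sqr_norm (a b : R) : 0 <= b -> a ^+ 2 <= b ^+ 2 -> `|a| <= b.
Proof. by move=> b0; rewrite -[a ^+ 2]real_normK ?num_real // ler_pXn2r ?nnegrE. Qed.

Lemma ler_sqr_abs (a b : R) : 0 <= b -> a ^+ 2 <= b ^+ 2 -> a <= b.
Proof. by move=> b0 /(ler_sqr_norm b0); apply: le_trans; rewrite ler_norm. Qed.

(** Any finite type may index the entries: with pairs of indices [l2] becomes the Frobenius norm,
    and families of matrix entries need not be packed into matrices. *)
Definition l2 (I : finType) (f : I -> R) : R := Num.sqrt (\sum_i f i ^+ 2).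

Section L2.
Variable I : finType.
Implicit Types f g : I -> R.

Lemma l2_ge0 f : 0 <= l2 f. Proof. exact: sqrtr_ge0. Qed.

Lemma sumsqr_ge0 f : 0 <= \sum_i f i ^+ 2.
Proof. by apply: sumr_ge0 => i _; exact: sqr_ge0. Qed.

Lemma sqr_l2 f : l2 f ^+ 2 = \sum_i f i ^+ 2.
Proof. by rewrite sqr_sqrtr // sumsqr_ge0. Qed.

Lemma eq_l2 f g : f =1 g -> l2 f = l2 g.
Proof. by move=> fg; congr Num.sqrt; apply: eq_bigr => i _; rewrite fg. Qed.

Lemma l2_le_sqr f c : 0 <= c -> \sum_i f i ^+ 2 <= c ^+ 2 -> l2 f <= c.
Proof. by move=> c0; rewrite -sqr_l2 ler_pXn2r // nnegrE l2_ge0. Qed.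

Lemma cauchy_sum f g : `|\sum_i f i * g i| <= l2 f * l2 g.
Proof.
apply: ler_sqr_norm; first by rewrite mulr_ge0 ?l2_ge0.
rewrite exprMn !sqr_l2.
apply: quad_disc => [|t]; first exact: sumsqr_ge0.
have -> : (\sum_i f i ^+ 2) * t ^+ 2 + 2 * (\sum_i f i * g i) * t
          + \sum_i g i ^+ 2 = \sum_i (f i * t + g i) ^+ 2.
  rewrite mulr_suml mulrAC mulr_sumr -!big_split /=.
  by apply: eq_bigr => i _; ring.
exact: sumsqr_ge0.
Qed.

Lemma ler_l2D f g : l2 (fun i => f i + g i) <= l2 f + l2 g.
Proof.
apply: l2_le_sqr; first by rewrite addr_ge0 ?l2_ge0.
rewrite sqrrD !sqr_l2.
have /ler_normlP [_ fg] := cauchy_sum f g.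
have -> : \sum_i (f i + g i) ^+ 2
  = \sum_i f i ^+ 2 + (\sum_i f i * g i) *+ 2 + \sum_i g i ^+ 2.
  by rewrite -sumrMnl -!big_split /=; apply: eq_bigr => i _; rewrite sqrrD.
by rewrite lerD2r lerD2l ler_wMn2r.
Qed.

Lemma l2Z c f : l2 (fun i => c * f i) = `|c| * l2 f.
Proof.
rewrite /l2 -sqrtr_sqr -sqrtrM ?sqr_ge0 // mulr_sumr.
by congr Num.sqrt; apply: eq_bigr => i _; rewrite exprMn.
Qed.

Lemma ler_l2 f g : (forall i, `|f i| <= g i) -> l2 f <= l2 g.
Proof.
move=> fg; apply: l2_le_sqr; rewrite ?l2_ge0 // sqr_l2.
apply: ler_sum => i _; rewrite -[f i ^+ 2]real_normK ?num_real //.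
by rewrite ler_pXn2r ?nnegrE // (le_trans _ (fg i)).
Qed.

Lemma ler_norm_l2 f i : `|f i| <= l2 f.
Proof.
apply: ler_sqr_norm; rewrite ?l2_ge0 // sqr_l2 (bigD1 i) //= lerDl.
by apply: sumr_ge0 => j _; exact: sqr_ge0.
Qed.

Lemma l2_0 : l2 (fun _ : I => 0) = 0.
Proof. by rewrite /l2 big1 ?sqrtr0 // => i _; rewrite expr0n. Qed.

Lemma ler_l2_sum (J : Type) (s : seq J) (F : J -> I -> R) :
  l2 (fun i => \sum_(l <- s) F l i) <= \sum_(l <- s) l2 (F l).
Proof.
elim: s => [|x s IH].
  by rewrite big_nil (eq_l2 (g := fun=> 0)) ?l2_0 // => i; rewrite big_nil.
rewrite big_cons (eq_l2 (g := fun i => F x i + \sum_(l <- s) F l i)); last first.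
  by move=> i; rewrite big_cons.
by apply: le_trans (ler_l2D _ _) _; rewrite lerD2l.
Qed.

Lemma l2_const f c : 0 <= c -> (forall i, `|f i| <= c) ->
  l2 f <= Num.sqrt #|I|%:R * c.
Proof.
move=> c0 fc; apply: l2_le_sqr; first by rewrite mulr_ge0 ?sqrtr_ge0.
rewrite exprMn sqr_sqrtr ?ler0n //.
have -> : #|I|%:R * c ^+ 2 = \sum_(i : I) c ^+ 2 by rewrite sumr_const mulr_natl.
apply: ler_sum => i _; rewrite -[f i ^+ 2]real_normK ?num_real //.
by rewrite ler_pXn2r ?nnegrE.
Qed.

Lemma l2_mask f (p : pred I) : l2 (fun i => if p i then f i else 0) <= l2 f.
Proof.
apply: l2_le_sqr; rewrite ?l2_ge0 // sqr_l2; apply: ler_sum => i _.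
by case: ifP => // _; rewrite expr0n sqr_ge0.
Qed.

End L2.

Lemma sum_pair (I J : finType) (F : I * J -> R) :
  \sum_p F p = \sum_i \sum_j F (i, j).
Proof. by rewrite pair_bigA; apply: eq_bigr => -[]. Qed.

Lemma l2_pairl (I J : finType) (f : I * J -> R) (g : I -> R) :
  (forall i, l2 (fun j => f (i, j)) <= g i) -> l2 f <= l2 g.
Proof.
move=> fg; apply: l2_le_sqr; rewrite ?l2_ge0 // sqr_l2.
rewrite sum_pair.
apply: ler_sum => i _; rewrite -sqr_l2 ler_pXn2r ?nnegrE ?l2_ge0 //.
by rewrite (le_trans _ (fg i)) ?l2_ge0.
Qed.

Lemma l2_pairr (I J : finType) (f : I * J -> R) (g : J -> R) :
  (forall j, l2 (fun i => f (i, j)) <= g j) -> l2 f <= l2 g.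
Proof.
move=> fg; apply: l2_le_sqr; rewrite ?l2_ge0 // sqr_l2.
rewrite sum_pair exchange_big /=.
apply: ler_sum => i _; rewrite -sqr_l2 ler_pXn2r ?nnegrE ?l2_ge0 //.
by rewrite (le_trans _ (fg i)) ?l2_ge0.
Qed.

Lemma l2_pair (I J : finType) (f : I * J -> R) :
  l2 (fun i => l2 (fun j => f (i, j))) = l2 f.
Proof.
by rewrite {1 3}/l2 sum_pair; congr Num.sqrt; apply: eq_bigr => i _; rewrite sqr_l2.
Qed.

Lemma l2_norm (I : finType) (f : I -> R) : l2 (fun i => `|f i|) = l2 f.
Proof. by congr Num.sqrt; apply: eq_bigr => i _; rewrite real_normK ?num_real. Qed.

Section Dot.
Variable m : nat.
Implicit Types (x y : 'cV[R]_m) (A : 'M[R]_m).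

Lemma dotC x y : dot x y = dot y x.
Proof. by apply: eq_bigr => k _; rewrite mulrC. Qed.

Lemma dotDl x y z : dot (x + y) z = dot x z + dot y z.
Proof. by rewrite -big_split; apply: eq_bigr => k _; rewrite mxE mulrDl. Qed.

Lemma dotZl a x y : dot (a *: x) y = a * dot x y.
Proof. by rewrite mulr_sumr; apply: eq_bigr => k _; rewrite mxE mulrA. Qed.

Lemma dotNl x y : dot (- x) y = - dot x y.
Proof. by rewrite -scaleN1r dotZl mulN1r. Qed.

Lemma dotDr x y z : dot x (y + z) = dot x y + dot x z.
Proof. by rewrite dotC dotDl !(dotC x). Qed.

Lemma dotZr a x y : dot x (a *: y) = a * dot x y.
Proof. by rewrite dotC dotZl dotC. Qed.

Lemma dotNr x y : dot x (- y) = - dot x y.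
Proof. by rewrite dotC dotNl dotC. Qed.

Lemma dot0l x : dot 0 x = 0.
Proof. by rewrite -(scale0r 0) dotZl mul0r. Qed.

Lemma dot0r x : dot x 0 = 0.
Proof. by rewrite dotC dot0l. Qed.

Lemma dot_sumr (I : Type) (s : seq I) (P : pred I) x (F : I -> 'cV[R]_m) :
  dot x (\sum_(i <- s | P i) F i) = \sum_(i <- s | P i) dot x (F i).
Proof.
elim/big_rec2: _ => [|i a b _ <-]; first exact: dot0r.
by rewrite dotDr.
Qed.

Lemma norm2E x : norm2 x = l2 (fun k => x k 0).
Proof. by congr Num.sqrt; apply: eq_bigr => k _; rewrite expr2. Qed.

Lemma norm2_ge0 x : 0 <= norm2 x. Proof. exact: sqrtr_ge0. Qed.

Lemma dot_ge0 x : 0 <= dot x x.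
Proof. by apply: sumr_ge0 => k _; rewrite -expr2 sqr_ge0. Qed.

Lemma sqr_norm2 x : norm2 x ^+ 2 = dot x x.
Proof. by rewrite sqr_sqrtr // dot_ge0. Qed.

Lemma cauchy_dot x y : `|dot x y| <= norm2 x * norm2 y.
Proof. by rewrite !norm2E; exact: cauchy_sum. Qed.

Lemma ler_norm2D x y : norm2 (x + y) <= norm2 x + norm2 y.
Proof.
rewrite !norm2E; apply: le_trans (ler_l2D _ _).
by rewrite (eq_l2 (g := fun k => x k 0 + y k 0)) // => k; rewrite mxE.
Qed.

Lemma norm2Z a x : norm2 (a *: x) = `|a| * norm2 x.
Proof.
rewrite !norm2E -l2Z; apply: eq_l2 => k; by rewrite mxE.
Qed.

Lemma norm2N x : norm2 (- x) = norm2 x.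
Proof. by rewrite -scaleN1r norm2Z normrN1 mul1r. Qed.

Lemma ler_norm2B x y : norm2 (x - y) <= norm2 x + norm2 y.
Proof. by rewrite -[norm2 y]norm2N ler_norm2D. Qed.

Lemma norm20 : norm2 (0 : 'cV[R]_m) = 0.
Proof. by rewrite -(scale0r 0) norm2Z normr0 mul0r. Qed.

Lemma norm2_eq0 x : (norm2 x == 0) = (x == 0).
Proof.
apply/eqP/eqP => [x0|->]; last exact: norm20.
apply/matrixP => i j; rewrite ord1 mxE; apply/eqP; rewrite -normr_le0.
by rewrite -x0 norm2E; exact: (ler_norm_l2 (fun k => x k 0)).
Qed.

Lemma norm2_gt0 x : (0 < norm2 x) = (x != 0).
Proof. by rewrite lt_def norm2_ge0 andbT norm2_eq0. Qed.

Lemma ler_norm2_sum (I : Type) (s : seq I) (P : pred I) (F : I -> 'cV[R]_m) :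
  norm2 (\sum_(i <- s | P i) F i) <= \sum_(i <- s | P i) norm2 (F i).
Proof.
elim/big_rec2: _ => [|i a b _ H]; first by rewrite norm20.
by apply: le_trans (ler_norm2D _ _) _; rewrite lerD2l.
Qed.

End Dot.

Lemma dot_mulmx m n (A : 'M[R]_(m, n)) x y : dot x (A *m y) = dot (A^T *m x) y.
Proof.
rewrite /dot.
under eq_bigr do rewrite mxE mulr_sumr.
rewrite exchange_big; apply: eq_bigr => l _ /=.
rewrite mxE mulr_suml; apply: eq_bigr => k _.
by rewrite mxE mulrCA mulrA.
Qed.

Lemma dot_delta m (x : 'cV[R]_m) k : dot (delta_mx k 0) x = x k 0.
Proof.
rewrite /dot (bigD1 k) //= big1 ?addr0 => [|i ik]; first by rewrite mxE !eqxx mul1r.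
by rewrite mxE (negPf ik) mul0r.
Qed.

Lemma norm2_delta m (k : 'I_m) : norm2 (delta_mx k 0 : 'cV[R]_m) = 1.
Proof. by rewrite /norm2 dot_delta mxE !eqxx sqrtr1. Qed.

Lemma mulmx_delta m n (A : 'M[R]_(m, n)) k : A *m delta_mx k 0 = col k A.
Proof. by rewrite colE. Qed.

Lemma mulmx_sum_cols m n (A : 'M[R]_(m, n)) (v : 'cV[R]_n) :
  A *m v = \sum_j v j 0 *: col j A.
Proof.
apply/matrixP => i j; rewrite ord1 mxE summxE; apply: eq_bigr => k _.
by rewrite !mxE mulrC.
Qed.

End EuclideanNorm.

(** * The seminorm of a positive semidefinite matrix *)

Section EnergyNorm.
Variables (R : realType) (m : nat) (A : 'M[R]_m).
Hypothesis symA : A^T = A.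
Hypothesis psdA : forall x, 0 <= dot x (A *m x).
Implicit Types x y : 'cV[R]_m.

Lemma dotAC x y : dot x (A *m y) = dot y (A *m x).
Proof. by rewrite dot_mulmx symA dotC. Qed.

Lemma normA_ge0 x : 0 <= normA A x. Proof. exact: sqrtr_ge0. Qed.

Lemma sqr_normA x : normA A x ^+ 2 = dot x (A *m x).
Proof. by rewrite sqr_sqrtr. Qed.

Lemma cauchyA x y : `|dot x (A *m y)| <= normA A x * normA A y.
Proof.
apply: ler_sqr_norm; first by rewrite mulr_ge0 ?normA_ge0.
rewrite exprMn !sqr_normA; apply: quad_disc => // t.
have := psdA (t *: x + y); rewrite mulmxDr -scalemxAr !(dotDl, dotDr, dotZl, dotZr).
by rewrite (dotAC y x); lra.
Qed.

Lemma sqr_normAD x y :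
  normA A (x + y) ^+ 2 = normA A x ^+ 2 + 2 * dot x (A *m y) + normA A y ^+ 2.
Proof. by rewrite !sqr_normA mulmxDr !(dotDl, dotDr) (dotAC y x); ring. Qed.

Lemma ler_normAD x y : normA A (x + y) <= normA A x + normA A y.
Proof.
apply: ler_sqr_abs; first by rewrite addr_ge0 ?normA_ge0.
rewrite sqr_normAD; have /ler_normlP [_ ] := cauchyA x y.
by rewrite sqrrD; lra.
Qed.

Lemma normAZ a x : normA A (a *: x) = `|a| * normA A x.
Proof.
by rewrite /normA -scalemxAr dotZl dotZr mulrA -expr2 sqrtrM ?sqr_ge0 // sqrtr_sqr.
Qed.

Lemma normA0 : normA A 0 = 0.
Proof. by rewrite -(scale0r 0) normAZ normr0 mul0r. Qed.

Lemma ler_normA_sum (I : Type) (s : seq I) (P : pred I) (F : I -> 'cV[R]_m) :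
  normA A (\sum_(i <- s | P i) F i) <= \sum_(i <- s | P i) normA A (F i).
Proof.
elim/big_rec2: _ => [|i a b _ H]; first by rewrite normA0.
by apply: le_trans (ler_normAD _ _) _; rewrite lerD2l.
Qed.

End EnergyNorm.

(** * Bounds on operator norms *)

Section OperatorNorm.
Variable R : realType.

(** Bounds on the spectral norm are carried in this form, which composes without suprema and stays
    meaningful for [n = 0], where [specnorm] is the supremum of an empty set. *)
Definition opbound m n (M : 'M[R]_(m, n)) (c : R) :=
  forall x, norm2 (M *m x) <= c * norm2 x.

Definition frob m n (M : 'M[R]_(m, n)) : R := l2 (fun p => M p.1 p.2).

(** The square of [norm2 (M^T *m y)] is the inner product of [M *m (M^T *m y)] and [y];
    Cauchy-Schwarz leaves one factor to cancel. *)
Lemma opbound_tr m n (M : 'M[R]_(m, n)) c : 0 <= c -> opbound M c -> opbound M^T c.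
Proof.
move=> c0 Mc y; have [->|y0] := eqVneq (M^T *m y) 0.
  by rewrite norm20 mulr_ge0 ?norm2_ge0.
rewrite -(@ler_pM2l _ (norm2 (M^T *m y))) ?norm2_gt0 // -expr2 sqr_norm2.
rewrite dot_mulmx trmxK.
apply: le_trans (ler_norm _) _; apply: le_trans (cauchy_dot _ _) _.
by rewrite mulrCA mulrA; apply: ler_wpM2r; rewrite ?norm2_ge0.
Qed.

Lemma opbound_frob m n (M : 'M[R]_(m, n)) : opbound M (frob M).
Proof.
move=> x; rewrite norm2E.
apply: (@le_trans _ _ (l2 (fun i => norm2 x * l2 (fun j => M i j)))).
  apply: ler_l2 => i; rewrite mxE mulrC norm2E; exact: cauchy_sum.
rewrite l2Z ger0_norm ?norm2_ge0 // mulrC ler_wpM2r ?norm2_ge0 //.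
apply: l2_le_sqr; rewrite ?l2_ge0 // /frob sqr_l2 sum_pair.
by apply: ler_sum => i _; rewrite sqr_l2.
Qed.

Lemma norm2_col m n (M : 'M[R]_(m, n)) c j : opbound M c -> norm2 (col j M) <= c.
Proof. by move=> /(_ (delta_mx j 0)); rewrite mulmx_delta norm2_delta mulr1. Qed.

Lemma l2_col m n (M : 'M[R]_(m, n)) j : l2 (fun i => M i j) = norm2 (col j M).
Proof. by rewrite norm2E; apply: eq_l2 => i; rewrite mxE. Qed.

Lemma frob_opbound m n (M : 'M[R]_(m, n)) c :
  0 <= c -> opbound M c -> frob M <= Num.sqrt n%:R * c.
Proof.
move=> c0 Mc; apply: le_trans (l2_pairr (g := fun=> c) _) _ => [j|].
  by rewrite l2_col norm2_col.
by apply: le_trans (l2_const c0 _) _ => [i|]; rewrite ?ger0_norm // card_ord.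
Qed.

Lemma l2_dot_cols m n (M : 'M[R]_(m, n)) c x : 0 <= c -> opbound M c ->
  l2 (fun i => dot (col i M) x) <= c * norm2 x.
Proof.
move=> c0 Mc; apply: le_trans (opbound_tr c0 Mc x).
rewrite norm2E le_eqVlt; apply/orP; left; apply/eqP; apply: eq_l2 => i.
by rewrite mxE; apply: eq_bigr => k _; rewrite !mxE.
Qed.

Lemma specnorm_has_sup m n (M : 'M[R]_(m, n)) : (0 < n)%N ->
  has_sup [set norm2 (M *m x) | x in [set x : 'cV[R]_n | norm2 x = 1]]%classic.
Proof.
move=> n0; split.
  exists (norm2 (M *m delta_mx (Ordinal n0) 0)); exists (delta_mx (Ordinal n0) 0) => //=.
  exact: norm2_delta.
exists (frob M) => _ [x /= x1 <-].
by apply: le_trans (opbound_frob M x) _; rewrite x1 mulr1.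
Qed.

Lemma specnorm_le m n (M : 'M[R]_(m, n)) c :
  (0 < n)%N -> opbound M c -> specnorm M <= c.
Proof.
move=> n0 Mc; apply: ge_sup; first by case: (specnorm_has_sup M n0).
by move=> _ [x /= x1 <-]; have := Mc x; rewrite x1 mulr1.
Qed.

Lemma specnormP m n (M : 'M[R]_(m, n)) : (0 < n)%N -> opbound M (specnorm M).
Proof.
move=> n0 x; have [->|x0] := eqVneq x 0.
  by rewrite mulmx0 !norm20 mulr0.
have xgt0 : 0 < norm2 x by rewrite norm2_gt0.
rewrite -ler_pdivrMr // mulrC.
have -> : (norm2 x)^-1 * norm2 (M *m x) = norm2 (M *m ((norm2 x)^-1 *: x)).
  by rewrite -scalemxAr norm2Z ger0_norm // invr_ge0 ltW.
apply: sup_upper_bound; first exact: specnorm_has_sup.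
exists ((norm2 x)^-1 *: x) => //=.
by rewrite norm2Z ger0_norm ?invr_ge0 ?ltW // mulVf ?gt_eqF.
Qed.

Lemma specnorm_ge0 m n (M : 'M[R]_(m, n)) : (0 < n)%N -> 0 <= specnorm M.
Proof.
move=> n0; have := specnormP M n0 (delta_mx (Ordinal n0) 0).
by rewrite norm2_delta mulr1; apply: le_trans; rewrite norm2_ge0.
Qed.

Lemma opbound_le m n (M : 'M[R]_(m, n)) c d : c <= d -> opbound M c -> opbound M d.
Proof. by move=> cd Mc x; apply: le_trans (Mc x) _; rewrite ler_wpM2r ?norm2_ge0. Qed.

End OperatorNorm.

(** * Extreme singular values *)

Section Spectral.
Variable R : realType.

(* Replaces compactness of the sphere: were [l%:M - S] invertible at the supremum
   [l] of the Rayleigh quotient of [S], then [l] could be decreased. *)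
Lemma psd_unitmx_coercive n (B : 'M[R]_n) :
  B^T = B -> (forall x, 0 <= dot x (B *m x)) -> B \in unitmx ->
  exists2 c, 0 < c & forall x, c * norm2 x ^+ 2 <= dot x (B *m x).
Proof.
move=> symB psdB uB.
pose b := frob B + 1; pose d := frob (invmx B) + 1.
have b0 : 0 < b by rewrite ltr_wpDl ?l2_ge0.
have d0 : 0 < d by rewrite ltr_wpDl ?l2_ge0.
have Bb : opbound B b by apply: opbound_le (opbound_frob B); rewrite lerDl.
have Bd : opbound (invmx B) d by apply: opbound_le (opbound_frob _); rewrite lerDl.
have bd0 : 0 < d ^+ 2 * b by rewrite mulr_gt0 ?exprn_gt0.
exists (d ^+ 2 * b)^-1 => [|x]; first by rewrite invr_gt0.
rewrite mulrC ler_pdivrMr // mulrC.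
set y := B *m x.
have xy : norm2 x <= d * norm2 y by rewrite -{1}[x]mul1mx -(mulVmx uB) -mulmxA.
have [y0|y_neq0] := eqVneq y 0.
  move: xy; rewrite y0 norm20 mulr0 => x0.
  have -> : norm2 x = 0 by apply/eqP; rewrite eq_le x0 norm2_ge0.
  by rewrite expr0n /= dot0r mulr0.
(* Cauchy-Schwarz in the form of [B], with [y = B x]: the fourth power of [norm2 y] is at most
   [dot y (B y) * dot x (B x)], whose first factor is at most [b * norm2 y ^+ 2]. *)
have yb : norm2 y ^+ 2 <= b * dot x y.
  have y2 : 0 < norm2 y ^+ 2 by rewrite exprn_gt0 // norm2_gt0.
  have := cauchyA symB psdB y x; rewrite -/y -sqr_norm2 ger0_norm ?sqr_ge0 // => H.
  have H2 : (norm2 y ^+ 2) ^+ 2 <= dot y (B *m y) * dot x y.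
    rewrite -(sqr_normA psdB y) -(sqr_normA psdB x) -exprMn ler_pXn2r ?nnegrE ?sqr_ge0 //.
    by rewrite mulr_ge0 ?normA_ge0.
  have yBy : dot y (B *m y) <= b * norm2 y ^+ 2.
    apply: le_trans (ler_norm _) _; apply: le_trans (cauchy_dot _ _) _.
    by rewrite mulrC expr2 mulrA ler_wpM2r ?norm2_ge0.
  rewrite -(ler_pM2l y2) -expr2; apply: le_trans H2 _.
  by rewrite mulrA [_ * b]mulrC ler_wpM2r // psdB.
have : norm2 x ^+ 2 <= (d * norm2 y) ^+ 2.
  by rewrite ler_pXn2r ?nnegrE ?norm2_ge0 // mulr_ge0 ?norm2_ge0 // ltW.
move=> /le_trans; apply; rewrite exprMn -(mulrA _ b) ler_wpM2l ?sqr_ge0 //.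
Qed.

Lemma sym_rayleigh_max n (S : 'M[R]_n) : (0 < n)%N -> S^T = S ->
  exists l, (exists2 x : 'cV_n, x != 0 & S *m x = l *: x) /\
            (forall x, dot x (S *m x) <= l * norm2 x ^+ 2).
Proof.
move=> n0 symS.
pose E := [set dot x (S *m x) | x in [set x : 'cV[R]_n | norm2 x = 1]]%classic.
have E0 : (E !=set0)%classic.
  pose e : 'cV[R]_n := delta_mx (Ordinal n0) 0.
  by exists (dot e (S *m e)); exists e => //=; exact: norm2_delta.
have supE : has_sup E.
  split=> //; exists (frob S) => _ [x /= x1 <-].
  apply: le_trans (ler_norm _) _; apply: le_trans (cauchy_dot _ _) _.
  by rewrite x1 mul1r; have := opbound_frob S x; rewrite x1 mulr1.
pose l := sup E.
have lP x : dot x (S *m x) <= l * norm2 x ^+ 2.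
  have [->|x0] := eqVneq x 0; first by rewrite dot0l norm20 expr0n mulr0.
  have xgt0 : 0 < norm2 x by rewrite norm2_gt0.
  rewrite -ler_pdivrMr ?exprn_gt0 //.
  apply: sup_upper_bound => //; exists ((norm2 x)^-1 *: x).
    by rewrite /= norm2Z ger0_norm ?invr_ge0 ?ltW // mulVf ?gt_eqF.
  by rewrite -scalemxAr dotZl dotZr mulrA -expr2 exprVn mulrC.
exists l; split=> //.
pose B := l%:M - S.
have symB : B^T = B by rewrite /B linearB /= tr_scalar_mx symS.
have BE x : dot x (B *m x) = l * norm2 x ^+ 2 - dot x (S *m x).
  by rewrite mulmxBl mul_scalar_mx dotDr dotNr dotZr sqr_norm2.
have psdB x : 0 <= dot x (B *m x) by rewrite BE subr_ge0.
have : B \notin unitmx.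
  apply/negP => uB; have [c c0 cP] := psd_unitmx_coercive symB psdB uB.
  have : l <= l - c.
    apply: ge_sup => // _ [x /= x1 <-].
    by have := cP x; rewrite BE x1 expr1n; lra.
  lra.
rewrite unitmxE unitfE negbK => /det0P [v v0 vB].
exists v^T; first by apply: contraNneq v0 => v0; rewrite -[v]trmxK v0 trmx0.
apply/eqP; rewrite -subr_eq0 -oppr_eq0 opprB -mul_scalar_mx -mulmxBl -/B.
by rewrite -symB -trmx_mul vB trmx0.
Qed.

Lemma sym_rayleigh_min n (S : 'M[R]_n) : (0 < n)%N -> S^T = S ->
  exists l, (exists2 x : 'cV_n, x != 0 & S *m x = l *: x) /\
            (forall x, l * norm2 x ^+ 2 <= dot x (S *m x)).
Proof.
move=> n0 symS; have symN : (- S)^T = - S by rewrite linearN /= symS.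
have [l [[x x0 xS] lP]] := sym_rayleigh_max n0 symN.
exists (- l); split.
  by exists x => //; rewrite scaleNr -xS mulNmx opprK.
by move=> y; have := lP y; rewrite mulNmx dotNr; lra.
Qed.

(** The interface to [kappa]: a quotient of constants in a two-sided bound on [M]. The extreme
    Rayleigh quotients of [M^T *m M] are eigenvalues, so their square roots are singular values, and
    the supremum and infimum lie on the right side of them. *)
Lemma kappaP m n (M : 'M[R]_(m, n)) : (0 < n)%N ->
  (forall v : 'cV_n, v != 0 -> M *m v != 0) ->
  exists s S : R, [/\ 0 < s, s <= S, kappa M = S / s,
    forall v, s * norm2 v <= norm2 (M *m v) & opbound M S].
Proof.
move=> n0 Minj.
have symG : (M^T *m M)^T = M^T *m M by rewrite trmx_mul trmxK.
have GE v : dot v (M^T *m M *m v) = norm2 (M *m v) ^+ 2.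
  by rewrite sqr_norm2 -mulmxA dot_mulmx trmxK.
have svE s : singular_values M s ->
    exists2 x : 'cV_n, x != 0 & s * norm2 x = norm2 (M *m x).
  case=> s0 /eigenvalueP [v vG v0]; exists v^T.
    by apply: contraNneq v0 => v0; rewrite -[v]trmxK v0 trmx0.
  have : norm2 (M *m v^T) ^+ 2 = (s * norm2 v^T) ^+ 2.
    rewrite -GE exprMn -symG -trmx_mul vG linearZ /= dotZr sqr_norm2 //.
  by move/eqP; rewrite eqrXn2 ?norm2_ge0 ?mulr_ge0 ?norm2_ge0 // => /eqP.
have eigE l (x : 'cV_n) : x != 0 -> M^T *m M *m x = l *: x ->
    norm2 (M *m x) ^+ 2 = l * norm2 x ^+ 2.
  by move=> x0 xl; rewrite -GE xl dotZr sqr_norm2.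
have sv_sqrt l (x : 'cV_n) : x != 0 -> M^T *m M *m x = l *: x ->
    0 < l /\ singular_values M (Num.sqrt l).
  move=> x0 xl; have lx := eigE _ _ x0 xl.
  have x2 : 0 < norm2 x ^+ 2 by rewrite exprn_gt0 ?norm2_gt0.
  have l0 : 0 < l.
    by rewrite -(pmulr_lgt0 _ x2) -lx exprn_gt0 // norm2_gt0 Minj.
  split=> //; split; first exact: sqrtr_ge0.
  apply/eigenvalueP; exists x^T; last by apply: contraNneq x0 => x0; rewrite -[x]trmxK x0 trmx0.
  by rewrite sqr_sqrtr ?ltW // -symG -trmx_mul xl linearZ.
have [L [[x x0 xL] LP]] := sym_rayleigh_max n0 symG.
have [l [[y y0 yl] lP]] := sym_rayleigh_min n0 symG.
have [L0 svL] := sv_sqrt _ _ x0 xL; have [l0 svl] := sv_sqrt _ _ y0 yl.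
have lsv s : singular_values M s -> Num.sqrt l <= s.
  move=> sv; have [v v0 sE] := svE s sv; case: sv => s0 _.
  have vgt0 : 0 < norm2 v by rewrite norm2_gt0.
  rewrite -(ler_pM2r vgt0) sE; apply: ler_sqr_abs; rewrite ?norm2_ge0 //.
  by rewrite exprMn sqr_sqrtr ?(ltW l0) // -GE lP.
have supSV : has_sup (singular_values M).
  split; first by exists (Num.sqrt L).
  exists (frob M) => s /svE [v v0 sE].
  have vgt0 : 0 < norm2 v by rewrite norm2_gt0.
  by rewrite -(ler_pM2r vgt0) sE; exact: opbound_frob.
have infSV : has_inf (singular_values M).
  split; first by exists (Num.sqrt L).
  by exists (Num.sqrt l); exact: lsv.
have inf_le : inf (singular_values M) <= Num.sqrt l by apply: ge_inf => //; case: infSV.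
have le_sup : Num.sqrt L <= sup (singular_values M) by apply: sup_upper_bound.
have inf_gt0 : 0 < inf (singular_values M).
  apply: (@lt_le_trans _ _ (Num.sqrt l)); first by rewrite sqrtr_gt0.
  by apply: lb_le_inf; [case: infSV | exact: lsv].
exists (inf (singular_values M)), (sup (singular_values M)); split=> //.
- by apply: le_trans inf_le _; apply: le_trans (lsv _ svL) _.
- move=> v; apply: (@le_trans _ _ (Num.sqrt l * norm2 v)).
    by rewrite ler_wpM2r ?norm2_ge0.
  apply: ler_sqr_abs; rewrite ?norm2_ge0 //.
  by rewrite exprMn sqr_sqrtr ?(ltW l0) // -GE lP.
- move=> v; apply: (@le_trans _ _ (Num.sqrt L * norm2 v)); last first.
    by rewrite ler_wpM2r ?norm2_ge0.
  apply: ler_sqr_abs; rewrite ?mulr_ge0 ?norm2_ge0 ?sqrtr_ge0 //.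
  by rewrite exprMn (sqr_sqrtr (ltW L0)) -GE LP.
Qed.

Lemma spd_kappaP m (A : 'M[R]_m) : (0 < m)%N -> spd A ->
  exists s S : R, [/\ 0 < s, kappa A = S / s,
    forall x, s * norm2 x ^+ 2 <= dot x (A *m x) & opbound A S].
Proof.
move=> m0 [symA posA].
have Ainj (v : 'cV_m) : v != 0 -> A *m v != 0.
  by move=> v0; apply: contraTneq (posA v v0) => ->; rewrite dot0r ltxx.
(* The least singular value bounds [norm2 (A *m x)]; to bound the quadratic form it is compared with
   the least eigenvalue [l], through [A y = l y]. *)
have [s [S [s0 sS kE sP SP]]] := kappaP m0 Ainj.
exists s, S; split=> //.
have [l [[y y0 yl] lP]] := sym_rayleigh_min m0 symA.
have ygt0 : 0 < norm2 y by rewrite norm2_gt0.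
have l0 : 0 < l.
  by have := posA y y0; rewrite yl dotZr -sqr_norm2 pmulr_lgt0 ?exprn_gt0.
have sl : s <= l.
  by have := sP y; rewrite yl norm2Z gtr0_norm // ler_pM2r.
by move=> x; apply: le_trans (lP x); rewrite ler_wpM2r ?sqr_ge0.
Qed.

End Spectral.

(** * Rounding errors of sums *)

Section FloatingSums.
Variable R : realType.

(* The sum of the absolute values of all the partial sums formed by [t]: [u]
   times this quantity is the first-order error of [fl_sum]. *)
Fixpoint node_sums (I : Type) (t : sum_order I) (w : I -> R) : R :=
  match t with
  | Term k => `|w k|
  | Add l r => node_sums l w + node_sums r w + `|\sum_(k <- terms t) w k|
  end.

Lemma node_sums_ge0 (I : Type) (t : sum_order I) (w : I -> R) : 0 <= node_sums t w.
Proof. by elim: t => //= l lt r rt; rewrite !addr_ge0. Qed.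

Section Tree.
Variables (u : R) (I : Type).
Hypothesis u_ge0 : 0 <= u.
Implicit Types (t : sum_order I) (x y : I -> R).

Lemma size_terms_gt0 t : (0 < size (terms t))%N.
Proof. by elim: t => //= l lt r rt; rewrite size_cat addn_gt0 lt. Qed.

Lemma ler_norm_terms t (w : I -> R) :
  `|\sum_(k <- terms t) w k| <= \sum_(k <- terms t) `|w k|.
Proof. exact: ler_norm_sum. Qed.

(** A crude bound by induction on the tree. The last addition multiplies the error of a subtree by
    at most [1 + u] and adds [u] times its sum; both effects are paid for by the factor 2 and by the
    other subtree having at least one leaf. *)
Lemma fl_sum_error t x y s : 2 * (size (terms t))%:R * u <= 1 -> fl_sum u t x y s ->
  `|s - \sum_(k <- terms t) x k * y k|
    <= 2 * (size (terms t))%:R * u * \sum_(k <- terms t) `|x k * y k|.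
Proof.
elim: t s => [k|l IHl r IHr] s /=.
  move=> _ [d du ->]; rewrite !big_seq1 mulrDr mulr1 addrAC subrr add0r normrM.
  rewrite mulrC ler_wpM2r ?normr_ge0 //; apply: le_trans du _; by have := u_ge0; lra.
rewrite size_cat natrD !big_cat /= => Nu [a [b [fa fb [d du ->]]]].
have Nl : (1 : R) <= (size (terms l))%:R by rewrite ler1n size_terms_gt0.
have Nr : (1 : R) <= (size (terms r))%:R by rewrite ler1n size_terms_gt0.
move: (IHl a) (IHr b) (ler_norm_terms l (fun k => x k * y k))
  (ler_norm_terms r (fun k => x k * y k)) Nu Nl Nr.
move: (\sum_(k <- terms l) x k * y k) (\sum_(k <- terms r) x k * y k) => sl sr.
have : 0 <= \sum_(k <- terms l) `|x k * y k| by apply: sumr_ge0.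
have : 0 <= \sum_(k <- terms r) `|x k * y k| by apply: sumr_ge0.
move: (\sum_(k <- terms l) _) (\sum_(k <- terms r) _) => al ar.
move: (size (terms l))%:R (size (terms r))%:R => nl nr.
move=> ar0 al0 Hl Hr sla srb Nu Nl Nr.
have {}Hl : `|a - sl| <= 2 * nl * u * al by apply: Hl => //; nra.
have {}Hr : `|b - sr| <= 2 * nr * u * ar by apply: Hr => //; nra.
have -> : (a + b) * (1 + d) - (sl + sr)
        = (a - sl) * (1 + d) + (b - sr) * (1 + d) + d * (sl + sr) by ring.
have d1 : `|1 + d| <= 1 + u by rewrite (le_trans (ler_normD _ _)) // normr1 lerD2l.
have H1 : `|(a - sl) * (1 + d)| <= 2 * nl * u * al * (1 + u).
  by rewrite normrM ler_pM.
have H2 : `|(b - sr) * (1 + d)| <= 2 * nr * u * ar * (1 + u).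
  by rewrite normrM ler_pM.
have H3 : `|d * (sl + sr)| <= u * (al + ar).
  by rewrite normrM ler_pM // (le_trans (ler_normD _ _)) // lerD.
apply: le_trans (ler_normD _ _) _; apply: le_trans (lerD (ler_normD _ _) H3) _.
apply: le_trans (lerD (lerD H1 H2) (lexx _)) _.
have E1 : 0 <= u * al * (2 * nr - 2 * nl * u - 1) by rewrite !mulr_ge0 //; nra.
have E2 : 0 <= u * ar * (2 * nl - 2 * nr * u - 1) by rewrite !mulr_ge0 //; nra.
lra.
Qed.

(** Refines [fl_sum_error] by isolating the first-order part. The remainder comes from replacing
    computed partial sums by exact ones, at a cost given by the crude bound. The size is bounded by
    a fixed [N], so that the coefficient does not change along the induction. *)
Lemma fl_sum_node_error (N : nat) t x y s :
  (size (terms t) <= N)%N -> 2 * N%:R * u <= 1 -> fl_sum u t x y s ->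
  `|s - \sum_(k <- terms t) x k * y k|
    <= u * node_sums t (fun k => x k * y k)
       + 2 * N%:R * u ^+ 2 * (size (terms t))%:R * \sum_(k <- terms t) `|x k * y k|.
Proof.
move=> sN Nu; have N0 : (0 : R) <= N%:R by rewrite ler0n.
elim: t s sN => [k|l IHl r IHr] s /=.
  move=> _ [d du ->]; rewrite !big_seq1 mulrDr mulr1 addrAC subrr add0r normrM.
  rewrite mulrC -[leLHS]addr0 lerD ?ler_wpM2r //.
  by rewrite !mulr_ge0 ?sqr_ge0.
move=> sN [a [b [fa fb [d du ->]]]].
rewrite size_cat in sN.
have sNl : (size (terms l) <= N)%N by apply: leq_trans sN; rewrite leq_addr.
have sNr : (size (terms r) <= N)%N by apply: leq_trans sN; rewrite leq_addl.
have leN k : (k <= N)%N -> 2 * k%:R * u <= 1.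
  by move=> kN; apply: le_trans Nu; rewrite ler_wpM2r // ler_wpM2l // ler_nat.
have := fl_sum_error (leN _ sNl) fa; have := fl_sum_error (leN _ sNr) fb.
move: (IHl a sNl fa) (IHr b sNr fb).
have Nl : (1 : R) <= (size (terms l))%:R by rewrite ler1n size_terms_gt0.
have Nr : (1 : R) <= (size (terms r))%:R by rewrite ler1n size_terms_gt0.
rewrite size_cat natrD !big_cat /=.
have {sNl}: (size (terms l))%:R <= N%:R :> R by rewrite ler_nat.
have {sNr}: (size (terms r))%:R <= N%:R :> R by rewrite ler_nat.
move: (\sum_(k <- terms l) x k * y k) (\sum_(k <- terms r) x k * y k) => sl sr.
have : 0 <= \sum_(k <- terms l) `|x k * y k| by apply: sumr_ge0.
have : 0 <= \sum_(k <- terms r) `|x k * y k| by apply: sumr_ge0.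
move: (\sum_(k <- terms l) _) (\sum_(k <- terms r) _) => al ar.
move: (size (terms l))%:R (size (terms r))%:R Nl Nr => nl nr Nl Nr.
move: (node_sums _ _) (node_sums _ _) => bl br.
move=> ar0 al0 nrN nlN Hl Hr Fr Fl.
have -> : (a + b) * (1 + d) - (sl + sr)
  = (a - sl) + (b - sr) + d * ((a - sl) + (b - sr)) + d * (sl + sr) by ring.
have H3 : `|d * (sl + sr)| <= u * `|sl + sr| by rewrite normrM ler_wpM2r.
have Gl : 2 * nl * u * al <= 2 * N%:R * u * al.
  by rewrite !ler_wpM2r // ler_wpM2l.
have Gr : 2 * nr * u * ar <= 2 * N%:R * u * ar.
  by rewrite !ler_wpM2r // ler_wpM2l.
have H2 : `|d * ((a - sl) + (b - sr))| <= u * (2 * N%:R * u * (al + ar)).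
  rewrite normrM ler_pM // (le_trans (ler_normD _ _)) //; lra.
have H1 := ler_normD (a - sl) (b - sr).
apply: le_trans (ler_normD _ _) _; apply: le_trans (lerD (ler_normD _ _) H3) _.
apply: le_trans (lerD (lerD H1 H2) (lexx _)) _.
apply: le_trans (lerD (lerD (lerD Hl Hr) (lexx _)) (lexx _)) _.
have c0 : 0 <= 2 * N%:R * u ^+ 2 by rewrite !mulr_ge0 ?sqr_ge0.
have E1 : 0 <= 2 * N%:R * u ^+ 2 * al * (nr - 1) by rewrite !mulr_ge0 ?sqr_ge0 //; lra.
have E2 : 0 <= 2 * N%:R * u ^+ 2 * ar * (nl - 1) by rewrite !mulr_ge0 ?sqr_ge0 //; lra.
lra.
Qed.

End Tree.

(* The partial sums at one node, for all [j] at once, are controlled together: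
   this is where it matters that the whole family is summed along one tree. *)
Lemma l2_node_sums (I J : finType) (t : sum_order I) (W : J -> I -> R) (b : R) :
  uniq (terms t) -> (forall S : pred I, l2 (fun j => \sum_(k | S k) W j k) <= b) ->
  l2 (fun j => node_sums t (W j)) <= 2 * (size (terms t))%:R * b.
Proof.
move=> Ut Wb.
have b0 : 0 <= b := le_trans (l2_ge0 _) (Wb pred0).
(* A binary tree with [N] leaves has [2 * N - 1] nodes, each contributing at most [b]. *)
suff : l2 (fun j => node_sums t (W j)) <= (2 * (size (terms t))%:R - 1) * b.
  by move=> /le_trans; apply; rewrite ler_wpM2r //; lra.
elim: t Ut => [k _|l IHl r IHr] /=.
  rewrite mulr1 [2 - 1](_ : _ = 1) ?mul1r; last by ring.
  rewrite l2_norm; apply: le_trans (Wb (pred1 k)).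
  by rewrite le_eqVlt; apply/orP; left; apply/eqP/eq_l2 => j; rewrite big_pred1_eq.
move=> Ut; have := Ut; rewrite cat_uniq => /and3P [/IHl {}IHl _ /IHr {}IHr].
rewrite size_cat natrD.
apply: le_trans (ler_l2D _ _) _.
have H : l2 (fun j => `|\sum_(k <- terms l ++ terms r) W j k|) <= b.
  rewrite l2_norm; apply: le_trans (Wb (mem (terms l ++ terms r))).
  rewrite le_eqVlt; apply/orP; left; apply/eqP/eq_l2 => j.
  by rewrite big_uniq.
apply: le_trans (lerD (ler_l2D _ _) H) _.
apply: le_trans (lerD (lerD IHl IHr) (lexx _)) _.
by rewrite le_eqVlt; apply/orP; left; apply/eqP; ring.
Qed.

Section Dimension.
Variables (m : nat) (u : R) (t : sum_order 'I_m).
Hypothesis u_ge0 : 0 <= u.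
Hypothesis tP : complete_order t.
Hypothesis mu1 : 2 * m%:R * u <= 1.

Lemma complete_size : size (terms t) = m.
Proof. by rewrite (perm_size tP) size_enum_ord. Qed.

Lemma complete_uniq : uniq (terms t).
Proof. by rewrite (perm_uniq tP) enum_uniq. Qed.

Lemma complete_sum (F : 'I_m -> R) : \sum_(k <- terms t) F k = \sum_k F k.
Proof. by rewrite (perm_big _ tP) big_enum. Qed.

Lemma sum_normM_le (f g : 'I_m -> R) : \sum_k `|f k * g k| <= l2 f * l2 g.
Proof.
apply: le_trans (ler_norm _) _.
under eq_bigr do rewrite normrM.
by rewrite -(l2_norm f) -(l2_norm g); exact: cauchy_sum.
Qed.

Lemma fl_sum_l2 (f g : 'I_m -> R) s : fl_sum u t f g s ->
  `|s - \sum_k f k * g k| <= u * node_sums t (fun k => f k * g k)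
     + 2 * m%:R ^+ 2 * u ^+ 2 * (l2 f * l2 g).
Proof.
move=> /(fl_sum_node_error u_ge0 (N := m)); rewrite complete_size => /(_ (leqnn _) mu1).
rewrite !complete_sum => /le_trans; apply; rewrite lerD2l.
have -> : 2 * m%:R * u ^+ 2 * m%:R = 2 * m%:R ^+ 2 * u ^+ 2 :> R by ring.
by rewrite ler_wpM2l ?sum_normM_le // !mulr_ge0 ?sqr_ge0.
Qed.

Lemma fl_dot_error x y s : fl_dot u t x y s ->
  `|s - dot x y| <= 2 * m%:R * u * (norm2 x * norm2 y).
Proof.
move=> /(fl_sum_error u_ge0); rewrite complete_size => /(_ mu1).
rewrite !complete_sum => /le_trans; apply.
by rewrite ler_wpM2l ?mulr_ge0 // !norm2E sum_normM_le.
Qed.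

(** No factor [Num.sqrt m%:R] is lost at first order: at a given node, the partial sums for all rows
    form [A] times a masked copy of [x]. Only the second-order remainder goes through the Frobenius
    norm of [A], and [2 * (m%:R * Num.sqrt m%:R * u) <= 1] absorbs it. *)
Lemma fl_mulmx_error (A : 'M[R]_m) a x y :
  opbound A a -> 0 <= a -> 2 * (m%:R * Num.sqrt m%:R * u) <= 1 -> fl_mulmx u t A x y ->
  norm2 (y - A *m x) <= 3 * (m%:R * u) * a * norm2 x.
Proof.
move=> Aa a0 hu fl.
have errk k : `|(y - A *m x) k 0| <= u * node_sums t (fun l => A k l * x l 0)
     + 2 * m%:R ^+ 2 * u ^+ 2 * norm2 x * l2 (fun l => A k l).
  have := fl_sum_l2 (fl k); rewrite -norm2E mulrA [2 * _ * _ * _ * l2 _]mulrAC.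
  by rewrite mulrAC !mxE mulrAC.
have nodes : l2 (fun k => node_sums t (fun l => A k l * x l 0))
             <= 2 * m%:R * (a * norm2 x).
  rewrite -[X in 2 * X%:R]complete_size; apply: l2_node_sums complete_uniq _ => S.
  pose xS : 'cV[R]_m := \col_l (if S l then x l 0 else 0).
  have xSx : norm2 xS <= norm2 x.
    rewrite !norm2E; apply: le_trans (l2_mask _ S); rewrite le_eqVlt; apply/orP; left.
    by apply/eqP/eq_l2 => l; rewrite mxE.
  apply: (@le_trans _ _ (norm2 (A *m xS))); last first.
    by apply: le_trans (Aa _) _; rewrite ler_wpM2l.
  rewrite norm2E le_eqVlt; apply/orP; left; apply/eqP/eq_l2 => k.
  rewrite mxE big_mkcond; apply: eq_bigr => l _; rewrite mxE.
  by case: (S l); rewrite ?mulr0.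
have frobA : l2 (fun k => l2 (fun l => A k l)) <= Num.sqrt m%:R * a.
  by apply: le_trans (frob_opbound a0 Aa); rewrite /frob -l2_pair.
rewrite norm2E; apply: le_trans (ler_l2 errk) _.
apply: le_trans (ler_l2D _ _) _; rewrite !l2Z.
have c0 : 0 <= 2 * m%:R ^+ 2 * u ^+ 2 * norm2 x.
  by rewrite !mulr_ge0 ?sqr_ge0 ?norm2_ge0.
rewrite (ger0_norm u_ge0) (ger0_norm c0).
apply: le_trans (lerD (ler_wpM2l u_ge0 nodes) (ler_wpM2l c0 frobA)) _.
have := ler_wpM2r (_ : 0 <= m%:R * u * a * norm2 x) hu.
rewrite !mulr_ge0 ?norm2_ge0 // => /(_ isT).
by move: (norm2 x) (m%:R : R) (Num.sqrt _) => X M h; lra.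
Qed.

End Dimension.

End FloatingSums.

(** * One step of the algorithm *)

(* [eta] is the relative error of one product by [A], measured in the energy
   norm; [small] is what the hypothesis on [C2] gives once [kappa (Ahalf *m Z)]
   is bounded below by 1. *)
Record fl_setting (R : realType) (m : nat) (A : 'M[R]_m) (al la u eta : R)
    (td tm : sum_order 'I_m) : Prop := FlSetting {
  fl_sym : A^T = A;
  fl_la_gt0 : 0 < la;
  fl_coercive : forall x, la * norm2 x ^+ 2 <= dot x (A *m x);
  fl_opbound : opbound A al;
  fl_la_le : la <= al;
  fl_u_gt0 : 0 < u;
  fl_m_gt0 : (0 < m)%N;
  fl_td : complete_order td;
  fl_tm : complete_order tm;
  fl_eta : eta = m%:R * u * (al / la);
  fl_small : 100 * 100 * 100 * (Num.sqrt m%:R * eta) <= 1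
}.

Lemma psdA (R : realType) (m : nat) (A : 'M[R]_m) (al la u eta : R)
    (td tm : sum_order 'I_m) (H : fl_setting A al la u eta td tm) x : 0 <= dot x (A *m x).
Proof.
have [hS hla hC hA hlal hu hm hd ht he hs] := H.
by apply: le_trans ((fl_coercive H) x); rewrite mulr_ge0 ?sqr_ge0 ?ltW. Qed.

Lemma small_unit (R : realType) (m : nat) (A : 'M[R]_m) (al la u eta : R)
    (td tm : sum_order 'I_m) (H : fl_setting A al la u eta td tm) : [/\ 0 < al, u <= m%:R * u, 0 < m%:R * u, m%:R * u <= eta
  & m%:R * u * al = eta * la].
Proof.
have [hS hla hC hA hlal hu hm hd ht he hs] := H.
have al0 : 0 < al by apply: lt_le_trans (fl_la_le H).
have m1 : (1 : R) <= m%:R by rewrite ler1n.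
have mu0 : 0 < m%:R * u by rewrite mulr_gt0 // (lt_le_trans _ m1).
split=> //.
- by rewrite ler_peMl // ltW.
- by rewrite (fl_eta H) ler_peMr ?(ltW mu0) // ler_pdivlMr // mul1r.
- by rewrite (fl_eta H) -[RHS]mulrA divfK // gt_eqF.
Qed.

Lemma small_eta (R : realType) (m : nat) (A : 'M[R]_m) (al la u eta : R)
    (td tm : sum_order 'I_m) (H : fl_setting A al la u eta td tm) : [/\ 0 < eta, 100 * 100 * 100 * eta <= 1
  & 100 * 100 * 100 * (m%:R * Num.sqrt m%:R * u) <= 1].
Proof.
have [hS hla hC hA hlal hu hm hd ht he hs] := H.
have [al0 _ mu0 mueta _] := small_unit H.
have m1 : (1 : R) <= m%:R by rewrite ler1n.
have h1 : (1 : R) <= Num.sqrt m%:R by rewrite -{1}[1]sqrtr1 ler_wsqrtr.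
have eta0 : 0 < eta := lt_le_trans mu0 mueta.
have heta : eta <= Num.sqrt m%:R * eta by rewrite ler_peMl // ltW.
have hmu : Num.sqrt m%:R * (m%:R * u) <= Num.sqrt m%:R * eta.
  by rewrite ler_wpM2l // sqrtr_ge0.
split=> //; first by have := fl_small H; lra.
by have := fl_small H; rewrite mulrAC mulrC; lra.
Qed.

Lemma sqrt_la_norm (R : realType) (m : nat) (A : 'M[R]_m) (al la u eta : R)
    (td tm : sum_order 'I_m) (H : fl_setting A al la u eta td tm) x : Num.sqrt la * norm2 x <= normA A x.
Proof.
have [hS hla hC hA hlal hu hm hd ht he hs] := H.
have psd := psdA H.
apply: ler_sqr_abs; first exact: normA_ge0.
by rewrite exprMn sqr_sqrtr ?(ltW (fl_la_gt0 H)) // sqr_normA.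
Qed.

Lemma la_norm_prod (R : realType) (m : nat) (A : 'M[R]_m) (al la u eta : R)
    (td tm : sum_order 'I_m) (H : fl_setting A al la u eta td tm) x y : la * (norm2 x * norm2 y) <= normA A x * normA A y.
Proof.
have [hS hla hC hA hlal hu hm hd ht he hs] := H.
have -> : la * (norm2 x * norm2 y)
  = (Num.sqrt la * norm2 x) * (Num.sqrt la * norm2 y).
  by rewrite mulrACA -expr2 sqr_sqrtr // ltW.
by rewrite ler_pM ?(sqrt_la_norm H) // mulr_ge0 ?sqrtr_ge0 ?norm2_ge0.
Qed.

Lemma normA_le (R : realType) (m : nat) (A : 'M[R]_m) (al la u eta : R)
    (td tm : sum_order 'I_m) (H : fl_setting A al la u eta td tm) x : normA A x <= Num.sqrt al * norm2 x.
Proof.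
have [hS hla hC hA hlal hu hm hd ht he hs] := H.
have psd := psdA H.
have [al0 _ _ _ _] := small_unit H.
apply: ler_sqr_abs; first by rewrite mulr_ge0 ?sqrtr_ge0 ?norm2_ge0.
rewrite exprMn (sqr_sqrtr (ltW al0)) sqr_normA //.
apply: le_trans (ler_norm _) _; apply: le_trans (cauchy_dot _ _) _.
by rewrite mulrC expr2 mulrA ler_wpM2r ?norm2_ge0.
Qed.

Lemma fl_divide_error (R : realType) (m : nat) (A : 'M[R]_m) (al la u eta : R)
    (td tm : sum_order 'I_m) (H : fl_setting A al la u eta td tm) (x : 'cV[R]_m) r y : fl_divide u x r y -> r != 0 ->
  norm2 (r *: y - x) <= u * norm2 x.
Proof.
have [hS hla hC hA hlal hu hm hd ht he hs] := H.
move=> fl r0; rewrite -(ger0_norm (ltW (fl_u_gt0 H))) !norm2E -l2Z.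
rewrite -[leRHS]l2_norm; apply: ler_l2 => k; rewrite !mxE; have [d du ->] := fl k.
have -> : r * (x k 0 / r * (1 + d)) - x k 0 = d * x k 0 by field.
by rewrite !normrM ler_wpM2r // (ger0_norm (ltW (fl_u_gt0 H))).
Qed.

Lemma fl_divide0 (R : realType) (m : nat) (A : 'M[R]_m) (al la u eta : R)
    (td tm : sum_order 'I_m) (H : fl_setting A al la u eta td tm) r (y : 'cV[R]_m) : fl_divide u 0 r y -> y = 0.
Proof.
have [hS hla hC hA hlal hu hm hd ht he hs] := H.
move=> fl; apply/matrixP => i j; rewrite ord1 mxE; have [d _ ->] := fl i.
by rewrite mxE !mul0r.
Qed.

(** The breakdown case: a relative error of zero is zero, so the column leaves only zeros behind.
    Keeping this case spares a hypothesis that no breakdown occurs. *)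
Lemma normalize0 (R : realType) (m : nat) (A : 'M[R]_m) (al la u eta : R)
    (td tm : sum_order 'I_m) (H : fl_setting A al la u eta td tm) (x q p : 'cV[R]_m) s r :
  fl_mulmx u tm A 0 x -> fl_dot u td 0 x s -> rounds u (Num.sqrt s) r ->
  fl_divide u 0 r q -> fl_divide u x r p -> [/\ r = 0, q = 0 & p = 0].
Proof.
have [hS hla hC hA hlal hu hm hd ht he hs] := H.
have [al0 umu mu0 mueta _] := small_unit H; have [eta0 eta1 h1] := small_eta H.
have mu1 : 2 * m%:R * u <= 1 by lra.
move=> flx fls [d _ ->] /(fl_divide0 H) q0 flp.
have x0 : x = 0.
  have := fl_mulmx_error (ltW (fl_u_gt0 H)) (fl_tm H) mu1 (fl_opbound H) (ltW al0) _ flx.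
  rewrite mulmx0 subr0 norm20 mulr0 => H1; apply/eqP; rewrite -norm2_eq0.
  by rewrite eq_le norm2_ge0 andbT H1 //; lra.
have s0 : s = 0.
  have := fl_dot_error (ltW (fl_u_gt0 H)) (fl_td H) mu1 fls.
  by rewrite dot0l norm20 mul0r mulr0 subr0 normr_le0 => /eqP.
rewrite s0 sqrtr0 mul0r; split=> //; apply: (fl_divide0 H); move: flp.
by rewrite x0; apply.
Qed.

(** The errors of normalization are small relative to the energy of [z], so [q] is nearly a unit
    vector however ill-conditioned [Z] is. The ratio [mu] is left free because the analysis is run
    with two different values of it. *)
Lemma normalize_error (R : realType) (m : nat) (A : 'M[R]_m) (al la u eta : R)
    (td tm : sum_order 'I_m) (H : fl_setting A al la u eta td tm) (z x q p : 'cV[R]_m) s r :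
  fl_mulmx u tm A z x -> fl_dot u td z x s -> rounds u (Num.sqrt s) r ->
  fl_divide u z r q -> fl_divide u x r p -> z != 0 ->
  [/\ norm2 (r *: q - z) <= u * norm2 z,
      norm2 (p - A *m q) <= 7 * (m%:R * u) * al * norm2 q,
      forall mu, norm2 z <= mu * normA A z -> norm2 q <= 2 * mu,
      `|normA A q ^+ 2 - 1| <= 14 * eta &
      `|r - dot q (A *m z)| <= 15 * (m%:R * u) * al * norm2 q * norm2 z].
Proof.
have [hS hla hC hA hlal hu hm hd ht he hs] := H.
have psd := psdA H.
have [al0 umu mu0 mueta mual] := small_unit H; have [eta0 eta1 h1] := small_eta H.
have u0 := fl_u_gt0 H.
have mu1 : 2 * m%:R * u <= 1 by lra.
move=> flx fls [d du rE] flq flp z0.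
have N0 : 0 < norm2 z by rewrite norm2_gt0.
set om := m%:R * u in umu mu0 mueta mual *.
set N := norm2 z in N0 *.
set a := dot z (A *m z).
have xerr : norm2 (x - A *m z) <= 3 * om * al * N.
  by apply: (fl_mulmx_error (ltW (fl_u_gt0 H)) (fl_tm H) mu1 (fl_opbound H) (ltW al0) _ flx); lra.
have AzN : norm2 (A *m z) <= al * N := fl_opbound H z.
have a0 : 0 < a by apply: lt_le_trans ((fl_coercive H) z); rewrite mulr_gt0 ?exprn_gt0.
have aN : a <= al * N ^+ 2.
  apply: le_trans (ler_norm _) _; apply: le_trans (cauchy_dot _ _) _.
  by rewrite -/N mulrC expr2 mulrA ler_wpM2r // ltW.
(* The common scale of the errors of [r ^+ 2]: 3 [T] from the product by [A], 3 [T] from the inner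
   product and 4 [T] from the square root. Coercivity gives [T <= eta * a]. *)
set T := om * al * N ^+ 2.
have T0 : 0 < T := mulr_gt0 (mulr_gt0 mu0 al0) (exprn_gt0 2 N0).
have Ta : T <= eta * a.
  by rewrite /T mual -mulrA ler_wpM2l ?(ltW eta0) //; exact: (fl_coercive H).
have Ta' : 100 * 100 * 100 * T <= a.
  apply: (@le_trans _ _ (100 * 100 * 100 * eta * a)); first lra.
  by rewrite ler_piMl // ltW.
have alN0 : 0 < al * N by rewrite mulr_gt0.
have uT : u * (al * N ^+ 2) <= T.
  by rewrite /T -mulrA ler_wpM2r // mulr_ge0 ?sqr_ge0 // ltW.
have om_alN : 100 * 100 * 100 * (om * (al * N)) <= al * N.
  by rewrite mulrA ler_piMl ?(ltW alN0) //; lra_using mueta eta1.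
have u_alN : u * (al * N) <= om * (al * N) by rewrite ler_wpM2r // ltW.
have xN : norm2 x <= 11 / 10 * (al * N).
  rewrite -[x](subrK (A *m z)); apply: le_trans (ler_norm2D _ _) _.
  lra_using xerr AzN om_alN alN0.
have zx : `|dot z x - a| <= 3 * T.
  have -> : dot z x - a = dot z (x - A *m z) by rewrite dotDr dotNr.
  apply: le_trans (cauchy_dot _ _) _; rewrite -/N.
  apply: le_trans (ler_wpM2l (ltW N0) xerr) _.
  by rewrite le_eqVlt; apply/orP; left; apply/eqP; rewrite /T; ring.
have szx : `|s - dot z x| <= 3 * T.
  apply: le_trans (fl_dot_error (ltW (fl_u_gt0 H)) (fl_td H) mu1 fls) _; rewrite -/N.
  have : N * norm2 x <= N * (11 / 10 * (al * N)) by rewrite ler_wpM2l // ltW.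
  move=> /(ler_wpM2l (ltW mu0)); have := T0; rewrite /T /om; clear; lra.
have sa : `|s - a| <= 6 * T.
  have -> : s - a = (s - dot z x) + (dot z x - a) by ring.
  by apply: le_trans (ler_normD _ _) _; lra_using szx zx.
have /andP [sa1 sa2] : a - 6 * T <= s <= a + 6 * T.
  by rewrite -ler_distl.
have s0 : 0 < s by lra_using sa1 Ta' T0.
have u1 : 100 * u <= 1 by lra_using umu mueta eta1 u0.
have [d1 d2] : - u <= d /\ d <= u by move: du; rewrite ler_norml => /andP.
have r2 : r ^+ 2 = s * (1 + d) ^+ 2 by rewrite rE exprMn sqr_sqrtr // ltW.
have r0 : 0 < r by rewrite rE mulr_gt0 ?sqrtr_gt0 //; lra_using d1 u1.
have dd : `|(1 + d) ^+ 2 - 1| <= 3 * u.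
  by rewrite ler_norml; apply/andP; split; clear - u0 u1 d1 d2; nra.
have r2s : `|r ^+ 2 - s| <= 4 * T.
  have -> : r ^+ 2 - s = s * ((1 + d) ^+ 2 - 1) by rewrite r2; ring.
  rewrite normrM (gtr0_norm s0).
  apply: le_trans (ler_wpM2l (ltW s0) dd) _.
  have : u * s <= u * (a + 6 * T) by rewrite ler_wpM2l // ltW.
  have : u * a <= u * (al * N ^+ 2) by rewrite ler_wpM2l // ltW.
  have : 100 * u * T <= T by rewrite ler_piMl // ltW.
  lra_using uT T0.
have r2a : `|r ^+ 2 - a| <= 10 * T.
  have -> : r ^+ 2 - a = (r ^+ 2 - s) + (s - a) by ring.
  by apply: le_trans (ler_normD _ _) _; lra_using r2s sa.
have /andP [ra1 ra2] : a - 10 * T <= r ^+ 2 <= a + 10 * T.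
  by rewrite -ler_distl.
have dz : norm2 (r *: q - z) <= u * N by apply: (fl_divide_error H); rewrite ?gt_eqF.
have dx : norm2 (r *: p - x) <= u * norm2 x by apply: (fl_divide_error H); rewrite ?gt_eqF.
have uN : 100 * (u * N) <= N by rewrite mulrA ler_piMl // ltW.
have rqN : r * norm2 q = norm2 (r *: q) by rewrite norm2Z gtr0_norm.
have rq1 : r * norm2 q <= 11 / 10 * N.
  rewrite rqN -[r *: q](subrK z); apply: le_trans (ler_norm2D _ _) _.
  by rewrite -/N; lra_using dz uN N0.
have rq2 : 9 / 10 * N <= r * norm2 q.
  have : norm2 z <= norm2 (r *: q) + norm2 (r *: q - z).
    by rewrite -{1}[z](subKr (r *: q)) ler_norm2B.
  by rewrite -rqN -/N; lra_using dz uN N0.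
have zAdz : `|dot (r *: q - z) (A *m z)| <= T.
  apply: le_trans (cauchy_dot _ _) _; apply: le_trans uT.
  have -> : u * (al * N ^+ 2) = (u * N) * (al * N) by ring.
  by rewrite ler_pM ?norm2_ge0.
split=> //.
- rewrite -(ler_pM2l r0).
  (* The three sources: the division giving [p], the product by [A], and the image under [A] of the
     error of the division giving [q]. *)
  have -> : r * norm2 (p - A *m q)
    = norm2 ((r *: p - x) + (x - A *m z) - A *m (r *: q - z)).
    rewrite -{1}(gtr0_norm r0) -norm2Z; congr norm2.
    rewrite mulmxBr -scalemxAr opprB scalerBr.
    by apply/matrixP => i j; rewrite !mxE; ring.
  apply: le_trans (ler_norm2B _ _) _.
  apply: le_trans (lerD (ler_norm2D _ _) ((fl_opbound H) _)) _.
  have : u * norm2 x <= u * (11 / 10 * (al * N)) by rewrite ler_wpM2l // ltW.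
  have : al * norm2 (r *: q - z) <= al * (u * N) by rewrite ler_wpM2l // ltW.
  have : om * al * (9 / 10 * N) <= om * al * (r * norm2 q).
    by rewrite ler_wpM2l // ltW // mulr_gt0.
  have : 0 <= om * (al * N) by rewrite mulr_ge0 // ltW.
  lra_using dx xerr u_alN.
- move=> mu zmu; rewrite -(ler_pM2l r0).
  have nA0 := normA_ge0 A z.
  have rA : 9 / 10 * normA A z <= r.
    by apply: ler_sqr_abs; rewrite ?(ltW r0) // exprMn sqr_normA // -/a; lra_using ra1 Ta' T0.
  have mu0' : 0 <= mu.
    rewrite leNgt; apply/negP => mun.
    have : mu * normA A z <= 0 by rewrite nmulr_rle0.
    by rewrite -/N in zmu; lra_using zmu N0.
  have := ler_wpM2l mu0' rA; rewrite -/N in zmu; lra_using zmu rq1 N0.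
- have rqE : r ^+ 2 * normA A q ^+ 2
    = a + 2 * dot (r *: q - z) (A *m z) + normA A (r *: q - z) ^+ 2.
    have -> : r ^+ 2 * normA A q ^+ 2 = normA A (r *: q) ^+ 2.
      by rewrite normAZ // exprMn (gtr0_norm r0).
    by rewrite -{1}[r *: q](subrK z) sqr_normAD // (sqr_normA psd z) -/a; ring.
  have dz2 : normA A (r *: q - z) ^+ 2 <= T.
    rewrite sqr_normA //; apply: le_trans (ler_norm _) _.
    apply: le_trans (cauchy_dot _ _) _.
    apply: (@le_trans _ _ ((u * N) * (al * N))).
      rewrite ler_pM ?norm2_ge0 //; apply: le_trans ((fl_opbound H) _) _.
      by rewrite ler_wpM2l ?(ltW al0) // (le_trans dz) //; lra_using uN N0.
    by apply: le_trans uT; rewrite le_eqVlt; apply/orP; left; apply/eqP; ring.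
  have dz3 := sqr_ge0 (normA A (r *: q - z)).
  have [zA1 zA2] : - T <= dot (r *: q - z) (A *m z) /\ dot (r *: q - z) (A *m z) <= T.
    by move: zAdz; rewrite ler_norml => /andP.
  have r20 : 0 < r ^+ 2 by rewrite exprn_gt0.
  have Tr : 13 * T <= 14 * eta * r ^+ 2.
    have : eta * (a - 10 * T) <= eta * r ^+ 2 by rewrite ler_wpM2l // ltW.
    have : 100 * 100 * 100 * eta * T <= T by rewrite ler_piMl // ltW.
    lra_using Ta T0.
  rewrite -(ler_pM2l r20) -{1}(gtr0_norm r20) -normrM mulrBr mulr1 rqE.
  by rewrite ler_norml; apply/andP; split; lra_using ra1 ra2 Tr dz2 dz3 zA1 zA2.
- rewrite -(ler_pM2l r0) -{1}(gtr0_norm r0) -normrM mulrBr -expr2.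
  have -> : r * dot q (A *m z) = a + dot (r *: q - z) (A *m z).
    by rewrite dotDl dotNl dotZl -/a; ring.
  have : om * al * N * (9 / 10 * N) <= om * al * N * (r * norm2 q).
    by rewrite ler_wpM2l // ltW // (mulr_gt0 (mulr_gt0 mu0 al0) N0).
  have [zA1 zA2] : - T <= dot (r *: q - z) (A *m z) /\ dot (r *: q - z) (A *m z) <= T.
    by move: zAdz; rewrite ler_norml => /andP.
  have TE : T = om * al * N * N by rewrite /T; ring.
  by rewrite -/N ler_norml => H1; apply/andP; split; lra_using H1 TE ra1 ra2 zA1 zA2 T0.
Qed.

Lemma fl_update_error (R : realType) (m : nat) (A : 'M[R]_m) (al la u eta : R)
    (td tm : sum_order 'I_m) (H : fl_setting A al la u eta td tm) (z : 'cV[R]_m) r q z' : fl_update u z r q z' ->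
  norm2 (z' - z + r *: q) <= u * norm2 z + 3 * u * `|r| * norm2 q.
Proof.
have [hS hla hC hA hlal hu hm hd ht he hs] := H.
have [al0 umu mu0 mueta mual] := small_unit H; have [eta0 eta1 h1] := small_eta H.
have u0 := fl_u_gt0 H; have u1 : u <= 1 by lra.
move=> fl.
have abs (x : 'cV[R]_m) : norm2 x = l2 (fun k => `|x k 0|) by rewrite l2_norm norm2E.
have -> : u * norm2 z + 3 * u * `|r| * norm2 q
  = l2 (fun k => u * `|z k 0|) + l2 (fun k => 3 * u * `|r| * `|q k 0|).
  have ru0 : 0 <= 3 * u * `|r| by rewrite !mulr_ge0 // ltW.
  by rewrite !l2Z -!abs (ger0_norm (ltW u0)) (ger0_norm ru0).
rewrite norm2E; apply: le_trans (ler_l2D _ _); apply: ler_l2 => k.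
have [c [d1 du1 cE] [d2 du2 zE]] := fl k.
rewrite !mxE zE cE.
have -> : (z k 0 - r * q k 0 * (1 + d1)) * (1 + d2) - z k 0 + r * q k 0
  = d2 * z k 0 - r * q k 0 * (d1 + d2 + d1 * d2) by ring.
apply: le_trans (ler_normB _ _) _; rewrite !normrM lerD ?ler_wpM2r //.
rewrite [X in _ <= X](_ : _ = `|r| * `|q k 0| * (3 * u)); last by ring.
rewrite ler_wpM2l ?mulr_ge0 //.
have : `|d1 * d2| <= u * 1 by rewrite normrM ler_pM // (le_trans du2).
have := ler_normD (d1 + d2) (d1 * d2); have := ler_normD d1 d2; lra.
Qed.

(* The first alternative of the hypothesis on [q] is a breakdown. *)
Lemma project_error (R : realType) (m : nat) (A : 'M[R]_m) (al la u eta : R)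
    (td tm : sum_order 'I_m) (H : fl_setting A al la u eta td tm) (p q z : 'cV[R]_m) r mu :
  norm2 (p - A *m q) <= 7 * (m%:R * u) * al * norm2 q ->
  q = 0 \/ `|normA A q ^+ 2 - 1| <= 14 * eta ->
  norm2 q <= 2 * mu -> norm2 z <= mu * normA A z ->
  fl_dot u td p z r ->
  [/\ `|r - dot q (A *m z)| <= 20 * eta * normA A z
    & forall z', fl_update u z r q z' ->
      norm2 (z' - z + r *: q) <= 9 * u * mu * normA A z].
Proof.
have [hS hla hC hA hlal hu hm hd ht he hs] := H.
have psd := psdA H.
have [al0 umu mu0 mueta mual] := small_unit H; have [eta0 eta1 h1] := small_eta H.
have u0 := fl_u_gt0 H; have mu1 : 2 * m%:R * u <= 1 by lra.
move=> e1 q1 qmu zmu fl.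
have nz0 := normA_ge0 A z.
have qA : normA A q <= 11 / 10.
  apply: ler_sqr_abs; first lra.
  case: q1 => [->|]; first by rewrite normA0 // expr0n /=; lra_using eta0.
  by rewrite ler_norml => /andP [_ q2]; lra_using q2 eta1.
set om := m%:R * u in e1 umu mu0 mueta mual *.
have pq : norm2 p <= 11 / 10 * (al * norm2 q).
  rewrite -[p](subrK (A *m q)); apply: le_trans (ler_norm2D _ _) _.
  have aq0 : 0 <= al * norm2 q by rewrite mulr_ge0 ?norm2_ge0 // ltW.
  have := fl_opbound H q.
  have : 100 * 100 * 100 * om * (al * norm2 q) <= al * norm2 q.
    rewrite ler_piMl //; lra_using mueta eta1.
  lra_using e1 aq0.
have rqz : `|r - dot q (A *m z)| <= 10 * om * al * (norm2 q * norm2 z).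
  have -> : r - dot q (A *m z) = (r - dot p z) + dot (p - A *m q) z.
    by rewrite dotDl dotNl [dot (A *m q) z]dotC (dotAC (fl_sym H) z); ring.
  apply: le_trans (ler_normD _ _) _.
  apply: le_trans (lerD (fl_dot_error (ltW u0) (fl_td H) mu1 fl) (cauchy_dot _ _)) _.
  have := ler_wpM2r (norm2_ge0 z) e1; have := ler_wpM2r (norm2_ge0 z) pq.
  move=> /(ler_wpM2l (ltW mu0)).
  have : 0 <= om * (al * (norm2 q * norm2 z)).
    by rewrite !mulr_ge0 ?norm2_ge0 // ltW.
  by rewrite /om; clear; lra.
(* As [m%:R * u * al = eta * la], the Euclidean norms can be traded for energy norms, and that of
   [q] is at most 11/10. *)
have rz : `|r - dot q (A *m z)| <= 11 * eta * normA A z.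
  apply: le_trans rqz _.
  have := (la_norm_prod H) q z; have := ler_wpM2r nz0 qA => Ha Hb.
  have := ler_wpM2l (ltW eta0) (le_trans Hb Ha).
  by move: mual => mual H1; rewrite -[10 * om * al]mulrA mual; lra_using H1.
(* Relaxed to 20 so that [err_coef] has one constant for all pairs: on the diagonal it is 15 times
   11/10. *)
split; first by apply: le_trans rz _; rewrite ler_wpM2r //; lra_using eta0.
move=> z' /(fl_update_error H) /le_trans; apply.
have r1 : `|r| <= 12 / 10 * normA A z.
  rewrite -[r](subrK (dot q (A *m z))); apply: le_trans (ler_normD _ _) _.
  have := cauchyA (fl_sym H) (psdA H) q z; have := ler_wpM2r nz0 qA.
  have : 100 * 100 * 100 * eta * normA A z <= normA A z by rewrite ler_piMl.
  lra_using rz nz0.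
have rq : `|r| * norm2 q <= (12 / 10 * normA A z) * (2 * mu).
  by rewrite ler_pM ?norm2_ge0.
have := ler_wpM2l (ltW u0) zmu; have := ler_wpM2l (ltW u0) rq.
have : 0 <= u * (mu * normA A z).
  rewrite mulr_ge0 ?(ltW u0) //; apply: le_trans zmu; exact: norm2_ge0.
lra_using u0.
Qed.

(** * Propagation of the errors *)

(* Here [z j i] is set to 0 for [i > j], so that the indices of [err_update] and
   [err_coef] range over all pairs; for [i = j], [err_update] bounds the error
   of the normalization. [la] is the least eigenvalue of [A], [sg] and [S] are
   the extreme singular values of [A^(1/2) Z], and [y] bounds the norm of [Q]. *)
Record mgs_errors (R : realType) (m n : nat) (A : 'M[R]_m) (al la u eta : R)
    (td : sum_order 'I_m) (y mu sg S : R) (Z P Q : 'M[R]_(m, n)) (r : 'M[R]_n)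
    (z : 'I_n -> nat -> 'cV[R]_m) : Prop := MgsErrors {
  err_init : forall j, z j 0%N = col j Z;
  err_end : forall j, z j n = 0;
  err_update : forall i j : 'I_n,
    norm2 (z j i.+1 - z j i + r i j *: col i Q) <= 9 * u * mu * normA A (z j i);
  err_coef : forall i j : 'I_n,
    `|r i j - dot (col i Q) (A *m z j i)| <= 20 * eta * normA A (z j i);
  err_unit : forall i, (forall j, r i j = 0) \/
    `|normA A (col i Q) ^+ 2 - 1| <= 14 * eta;
  err_q : forall i, norm2 (col i Q) <= 2 * mu;
  err_p : forall i, norm2 (col i P - A *m col i Q)
    <= 7 * (m%:R * u) * al * norm2 (col i Q);
  err_dot : forall i j : 'I_n, (i < j)%N ->
    `|r i j - dot (col i P) (z j i)| <=
      u * node_sums td (fun k => P k i * z j i k 0)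
      + 2 * m%:R ^+ 2 * u ^+ 2 * (norm2 (col i P) * norm2 (z j i));
  err_diag : forall j, `|r j j - dot (col j Q) (A *m z j j)|
    <= 15 * (m%:R * u) * al * norm2 (col j Q) * norm2 (z j j);
  err_low : forall i j : 'I_n, (j < i)%N -> r i j = 0 /\ z j i = 0;
  err_mu : forall i j : 'I_n, norm2 (z j i) <= mu * normA A (z j i);
  err_mu0 : 0 <= mu;
  err_mula : mu ^+ 2 * la <= 1;
  err_Q : opbound Q y;
  err_y0 : 0 <= y;
  err_ymu : y * mu * la <= 4;
  err_Zup : forall v, normA A (Z *m v) <= S * norm2 v;
  err_Zlo : forall v, sg * norm2 v <= normA A (Z *m v);
  err_sg : 0 < sg;
  err_sgS : sg <= S;
  err_small : 100 * 100 * 100 * (Num.sqrt m%:R * eta * S) <= sg;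
  err_n : (0 < n <= m)%N
}.

Section TailSums.
Variables (n : nat) (V : zmodType) (F : 'I_n -> V).

Lemma tail_sum_recl (i : 'I_n) :
  \sum_(l < n | (i <= l)%N) F l = F i + \sum_(l < n | (i < l)%N) F l.
Proof.
rewrite (bigD1 i) //=; congr (_ + _); apply: eq_bigl => l.
by rewrite ltn_neqAle andbC eq_sym.
Qed.

Lemma head_sum_recr (i : 'I_n) :
  \sum_(l < n | (l < i.+1)%N) F l = \sum_(l < n | (l < i)%N) F l + F i.
Proof.
rewrite (bigD1 i) //= addrC; congr (_ + _); apply: eq_bigl => l.
by rewrite ltnS [RHS]ltn_neqAle andbC.
Qed.

Lemma tail_sum_telescope (x : nat -> V) : x n = 0 ->
  (forall i : 'I_n, x i = F i + x i.+1) ->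
  forall i : nat, (i <= n)%N -> x i = \sum_(l < n | (i <= l)%N) F l.
Proof.
move=> xn step i le_in; move: {2}(n - i)%N (erefl (n - i)%N) le_in => d.
elim: d i => [|d IH] i nid le_in.
  have -> : i = n by apply/eqP; rewrite eqn_leq le_in -subn_eq0 nid.
  by rewrite xn big_pred0 // => l; rewrite leqNgt ltn_ord.
have lt_in : (i < n)%N by rewrite -subn_gt0 nid.
rewrite (tail_sum_recl (Ordinal lt_in)) -(IH i.+1) ?subnS ?nid //.
exact: (step (Ordinal lt_in)).
Qed.

End TailSums.

Section ErrorAnalysis.
Variables (R : realType) (m n : nat) (A : 'M[R]_m) (al la u eta : R).
Variables (td tm : sum_order 'I_m) (y mu sg S : R) (Z P Q : 'M[R]_(m, n)).
Variables (r : 'M[R]_n) (z : 'I_n -> nat -> 'cV[R]_m).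
Hypothesis HS : fl_setting A al la u eta td tm.
Hypothesis HE : mgs_errors A al la u eta td y mu sg S Z P Q r z.

Local Notation h := (Num.sqrt m%:R : R).
Local Notation q i := (col i Q).
Local Notation phi := (m%:R * u * h * al * y * mu).
Local Notation tau := (h * eta).

Definition upd_err (i j : 'I_n) := z j i.+1 - z j i + r i j *: q i.
Definition coef_err (i j : 'I_n) := r i j - dot (q i) (A *m z j i).
Definition tail_vec (j : 'I_n) (i : nat) := \sum_(l < n | (i <= l)%N) r l j *: q l.
Definition tail_err (j : 'I_n) (i : nat) := \sum_(l < n | (i <= l)%N) upd_err l j.

Lemma m_ge1 : (1 : R) <= m%:R. Proof. by rewrite ler1n (fl_m_gt0 HS). Qed.
Lemma h_ge1 : 1 <= h. Proof. by rewrite -{1}[1]sqrtr1 ler_wsqrtr // m_ge1. Qed.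
Lemma sqr_h : h ^+ 2 = m%:R. Proof. by rewrite sqr_sqrtr. Qed.
Lemma n_le_m : n%:R <= m%:R :> R.
Proof. by have /andP [_ nm] := err_n HE; rewrite ler_nat. Qed.
Lemma sqrtn_le_h : Num.sqrt n%:R <= h. Proof. by rewrite ler_wsqrtr // n_le_m. Qed.
Lemma S_gt0 : 0 < S. Proof. exact: lt_le_trans (err_sg HE) (err_sgS HE). Qed.
Lemma eta_gt0 : 0 < eta. Proof. by case: (small_eta HS). Qed.
Lemma al_gt0 : 0 < al. Proof. by case: (small_unit HS). Qed.
Lemma tau_small : 100 * 100 * 100 * tau <= 1. Proof. exact: fl_small HS. Qed.

Lemma tau_bounds : [/\ 0 < tau, eta <= tau, m%:R * u * h <= tau & m%:R * eta ^+ 2 = tau ^+ 2].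
Proof.
have [_ _ _ mueta _] := small_unit HS; have h1 := h_ge1; have e0 := eta_gt0.
split; last by rewrite exprMn sqr_h.
- by rewrite mulr_gt0 // (lt_le_trans _ h1).
- by rewrite ler_peMl // ltW.
- by rewrite mulrC ler_wpM2l // (le_trans _ h1).
Qed.

(** Arranged so that [- c ^+ 2] is the loss of energy in an exact projection; the other two terms
    are the defects of the coefficient and of the length of [q]. *)
Lemma project_energy i (x : 'cV[R]_m) c :
  normA A (x - c *: q i) ^+ 2 = normA A x ^+ 2 - c ^+ 2
    + 2 * c * (c - dot (q i) (A *m x)) + c ^+ 2 * (normA A (q i) ^+ 2 - 1).
Proof.
have psd := psdA HS; rewrite -scaleNr sqr_normAD ?(fl_sym HS) // normAZ // exprMn.
rewrite real_normK ?num_real // -scalemxAr dotZr (dotAC (fl_sym HS) x); ring.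
Qed.

(** With [e] the error of the coefficient, the energy changes by at most [- c ^+ 2 / 2 + 2 * c * e],
    which is at most [2 * e ^+ 2]: a wrong coefficient costs only its square. *)
Lemma project_energy_le i (x : 'cV[R]_m) c :
  c = 0 \/ `|normA A (q i) ^+ 2 - 1| <= 14 * eta ->
  normA A (x - c *: q i) ^+ 2
    <= normA A x ^+ 2 + 2 * (c - dot (q i) (A *m x)) ^+ 2.
Proof.
rewrite project_energy; set e := c - _.
case=> [->|/ler_normlP [_ H]].
  rewrite expr0n /= !(mulr0, mul0r, subr0, addr0) lerDl mulr_ge0 ?sqr_ge0 //.
have e1 : 14 * eta <= 1 / 2.
  by have := tau_small; have [t0 et _ _] := tau_bounds; lra.
have : c ^+ 2 * (normA A (q i) ^+ 2 - 1) <= c ^+ 2 * (1 / 2).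
  by rewrite ler_wpM2l ?sqr_ge0 // (le_trans H).
have := sqr_ge0 (c - 2 * e); rewrite sqrrB; move: (normA A _ ^+ 2 - 1) => k; lra.
Qed.

Lemma sqrt_al_mu : Num.sqrt al * mu <= al / la.
Proof.
have a0 := al_gt0; have l0 := fl_la_gt0 HS.
apply: ler_sqr_abs; first by rewrite divr_ge0 ?ltW.
rewrite exprMn (sqr_sqrtr (ltW a0)).
have k1 : 1 <= al / la by rewrite ler_pdivlMr // mul1r (fl_la_le HS).
have : al * mu ^+ 2 <= al / la.
  rewrite ler_pdivlMr // -mulrA -[leRHS]mulr1 ler_wpM2l ?(ltW a0) //.
  exact: err_mula HE.
by move=> /le_trans; apply; rewrite expr2 ler_peMl // (le_trans _ k1).
Qed.

Lemma normA_upd_err (i j : 'I_n) : normA A (upd_err i j) <= 9 * (u * (al / la)) * normA A (z j i).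
Proof.
have u0 := fl_u_gt0 HS.
apply: le_trans (normA_le HS _) _.
apply: le_trans (ler_wpM2l (sqrtr_ge0 _) (err_update HE i j)) _.
have -> : Num.sqrt al * (9 * u * mu * normA A (z j i))
  = 9 * u * normA A (z j i) * (Num.sqrt al * mu) by ring.
have -> : 9 * (u * (al / la)) * normA A (z j i)
  = 9 * u * normA A (z j i) * (al / la) by ring.
by rewrite ler_wpM2l ?sqrt_al_mu // !mulr_ge0 ?normA_ge0 // ltW.
Qed.

Lemma normA_colZ j : normA A (col j Z) <= S.
Proof. by have := err_Zup HE (delta_mx j 0); rewrite mulmx_delta norm2_delta mulr1. Qed.

(** One step multiplies the norm by at most [1 + g]. Since coefficient errors enter squared, [m]
    steps cost a multiple of [m%:R * eta ^+ 2 = tau ^+ 2], whereas [m%:R * eta] need not be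
    small. *)
Lemma normA_z j (i : nat) : (i <= n)%N -> normA A (z j i) <= 2 * S.
Proof.
pose g := 400 * eta ^+ 2 + 9 * (u * (al / la)).
have u0 := fl_u_gt0 HS; have S0 := S_gt0; have a0 := al_gt0; have l0 := fl_la_gt0 HS.
have k0 : 0 <= u * (al / la) by rewrite !mulr_ge0 ?invr_ge0 // ltW.
have g0 : 0 <= g by have := sqr_ge0 eta; rewrite /g; lra.
have mg : m%:R * g <= 1 / 2.
  have [t0 et _ mt] := tau_bounds; have ts := tau_small.
  have -> : m%:R * g = 400 * (m%:R * eta ^+ 2) + 9 * (m%:R * u * (al / la)).
    by rewrite /g; ring.
  rewrite mt -(fl_eta HS); have : tau * tau <= tau * 1 by rewrite ler_wpM2l //; lra.
  by rewrite -expr2; lra.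
have ng (k : nat) : (k <= n)%N -> 2 * k%:R * g <= 1.
  move=> kn; have : k%:R * g <= m%:R * g.
    by rewrite ler_wpM2r // (le_trans _ n_le_m) // ler_nat.
  lra.
have step (k : 'I_n) : normA A (z j k.+1) <= (1 + g) * normA A (z j k).
  have -> : z j k.+1 = (z j k - r k j *: q k) + upd_err k j.
    by rewrite /upd_err; apply/matrixP => a b; rewrite !mxE; ring.
  apply: le_trans (ler_normAD (fl_sym HS) (psdA HS) _ _) _.
  have X0 := normA_ge0 A (z j k).
  have H1 : normA A (z j k - r k j *: q k) <= (1 + 400 * eta ^+ 2) * normA A (z j k).
    have e0 := sqr_ge0 eta.
    apply: ler_sqr_abs; first by rewrite mulr_ge0 //; lra.
    have Hor : r k j = 0 \/ `|normA A (q k) ^+ 2 - 1| <= 14 * eta.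
      by case: (err_unit HE k) => [/(_ j)|]; [left | right].
    apply: le_trans (project_energy_le _ Hor) _.
    have : (r k j - dot (q k) (A *m z j k)) ^+ 2 <= (20 * eta * normA A (z j k)) ^+ 2.
      rewrite -real_normK ?num_real // ler_pXn2r ?nnegrE ?(err_coef HE) //.
      by rewrite !mulr_ge0 // ltW // eta_gt0.
    rewrite !exprMn; move: (_ ^+ 2) => t tX.
    have : 0 <= (eta ^+ 2) ^+ 2 * normA A (z j k) ^+ 2 by rewrite mulr_ge0 ?sqr_ge0.
    lra.
  have := normA_upd_err k j; rewrite /g; lra.
suff H k : (k <= n)%N -> normA A (z j k) <= (1 + 2 * k%:R * g) * S.
  by move=> le_in; apply: le_trans (H _ le_in) _; rewrite ler_wpM2r ?(ltW S0) //; have := ng _ le_in; lra.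
elim: k => [|k IH] kn.
  by rewrite mulr0 mul0r addr0 mul1r (err_init HE) normA_colZ.
apply: le_trans (step (Ordinal kn)) _ => /=.
apply: le_trans (ler_wpM2l _ (IH (ltnW kn))) _; first lra.
rewrite mulrA ler_wpM2r ?(ltW S0) // -[k.+1%:R]natr1.
have := ler_wpM2r g0 (ng _ (ltnW kn)); move: (k%:R : R) => t; lra.
Qed.

(** Solves the recurrence backwards from the zero vector at step [n], so that [z j i] is expressed
    by the columns of [Q] from [i] on. *)
Lemma z_tail j (i : nat) : (i <= n)%N -> z j i = tail_vec j i - tail_err j i.
Proof.
move=> le_in; rewrite /tail_vec /tail_err -sumrB.
apply: (tail_sum_telescope (x := z j)) le_in => [|k]; first exact: (err_end HE).
by rewrite /upd_err; apply/matrixP => a b; rewrite !mxE; ring.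
Qed.

Lemma norm2_upd_err i j : norm2 (upd_err i j) <= 18 * u * mu * S.
Proof.
apply: le_trans (err_update HE i j) _.
have := normA_z j (ltnW (ltn_ord i)).
have um : 0 <= u * mu by rewrite mulr_ge0 ?(err_mu0 HE) // ltW // (fl_u_gt0 HS).
by move=> /(ler_wpM2l um); lra.
Qed.

Lemma norm2_tail_err j i : norm2 (tail_err j i) <= 18 * (m%:R * u) * mu * S.
Proof.
apply: le_trans (ler_norm2_sum _ _ _) _.
have c0 : 0 <= 18 * u * mu * S.
  by rewrite !mulr_ge0 ?(err_mu0 HE) // ltW // ?(fl_u_gt0 HS) // S_gt0.
apply: (@le_trans _ _ (\sum_(l < n) 18 * u * mu * S)).
  rewrite big_mkcond; apply: ler_sum => l _; case: ifP => // _.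
  exact: norm2_upd_err.
rewrite sumr_const card_ord -[_ *+ n]mulr_natl.
apply: le_trans (ler_wpM2r c0 n_le_m) _.
by rewrite le_eqVlt; apply/orP; left; apply/eqP; ring.
Qed.

Lemma norm2_z j (i : 'I_n) : norm2 (z j i) <= 2 * mu * S.
Proof.
apply: le_trans (err_mu HE i j) _.
by have := ler_wpM2l (err_mu0 HE) (normA_z j (ltnW (ltn_ord i))); lra.
Qed.

Lemma l2_const_n (f : 'I_n -> R) c : (forall i, `|f i| <= c) -> 0 <= c -> l2 f <= h * c.
Proof.
move=> fc c0; apply: le_trans (l2_const c0 fc) _.
by rewrite card_ord ler_wpM2r // sqrtn_le_h.
Qed.

Lemma l2_const_nn (f : 'I_n * 'I_n -> R) c :
  (forall p, `|f p| <= c) -> 0 <= c -> l2 f <= m%:R * c.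
Proof.
move=> fc c0; apply: le_trans (l2_const c0 fc) _.
rewrite card_prod card_ord natrM -expr2 sqrtr_sqr ger0_norm //.
by rewrite ler_wpM2r // n_le_m.
Qed.

(** Row [i] is [r^T] applied to the part [l >= i] of row [i] of [X^T Q]. Truncation to the upper
    triangle is harmless in the Frobenius norm, unlike in the spectral norm. *)
Lemma l2_dot_tail (X : 'I_n -> 'cV[R]_m) rho : 0 <= rho -> opbound r rho ->
  l2 (fun p : 'I_n * 'I_n => dot (X p.1) (tail_vec p.2 p.1))
    <= rho * l2 (fun p : 'I_n * 'I_n => dot (X p.1) (q p.2)).
Proof.
move=> rho0 rhoP; rewrite -[X in _ * X]l2_pair.
rewrite -{1}(ger0_norm rho0) -l2Z.
apply: l2_pairl => i /=.
pose t : 'cV[R]_n := \col_l (if (i <= l)%N then dot (X i) (q l) else 0).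
have -> : l2 (fun j => dot (X i) (tail_vec j i)) = norm2 (r^T *m t).
  rewrite norm2E; apply: eq_l2 => j; rewrite /tail_vec dot_sumr mxE big_mkcond /=.
  by apply: eq_bigr => l _; rewrite !mxE; case: ifP; rewrite ?mulr0 // dotZr.
apply: le_trans (opbound_tr rho0 rhoP t) _; rewrite ler_wpM2l //.
rewrite norm2E (eq_l2 (g := fun l : 'I_n => if (i <= l)%N then dot (X i) (q l) else 0)).
  exact: l2_mask.
by move=> l; rewrite mxE.
Qed.

(** Pays for terms of second order: an entrywise bound over all pairs costs a factor [m], and a
    spare factor [m%:R * u] turns it into [h] times the small [tau]. *)
Lemma m_omega_le : m%:R * (m%:R * u) <= h * tau.
Proof.
have [_ _ mt _] := tau_bounds.
have -> : m%:R * (m%:R * u) = h * (m%:R * u * h).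
  by rewrite -{1}sqr_h; ring.
by rewrite ler_wpM2l // sqrtr_ge0.
Qed.

Lemma norm2_q_y i : norm2 (q i) <= y. Proof. exact: norm2_col (err_Q HE). Qed.

Lemma norm2_err_p i : norm2 (col i P - A *m q i) <= 7 * (m%:R * u) * al * y
  /\ norm2 (col i P - A *m q i) <= 14 * (m%:R * u) * al * mu.
Proof.
have [a0 _ mu0 _ _] := small_unit HS; have u0 := ltW (fl_u_gt0 HS); have a0' := ltW a0.
have c0 : 0 <= 7 * (m%:R * u) * al by rewrite !mulr_ge0 // ltW.
split; apply: le_trans (err_p HE i) _; first by rewrite ler_wpM2l // norm2_q_y.
by have := ler_wpM2l c0 (err_q HE i); lra.
Qed.

Lemma opboundP : opbound P (2 * al * y).
Proof.
have [a0 _ mu0 _ _] := small_unit HS; have u0 := ltW (fl_u_gt0 HS); have a0' := ltW a0.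
have y0 := err_y0 HE.
have [t0 _ mt _] := tau_bounds; have ts := tau_small.
have c0 : 0 <= 7 * (m%:R * u) * al * y by rewrite !mulr_ge0 // ltW.
have aly : 0 <= al * y by rewrite mulr_ge0 // ltW.
have E : frob (P - A *m Q) <= al * y.
  apply: le_trans (l2_pairr (g := fun=> 7 * (m%:R * u) * al * y) _) _ => [j|].
    rewrite l2_col linearB /= [col j (A *m Q)]colE -mulmxA -colE.
    by have [] := norm2_err_p j.
  apply: le_trans (l2_const_n (c := 7 * (m%:R * u) * al * y) _ c0) _ => [i|].
    by rewrite ger0_norm.
  have -> : h * (7 * (m%:R * u) * al * y) = 7 * (m%:R * u * h) * (al * y) by ring.
  by rewrite ler_piMl //; lra.
move=> v; rewrite -[P](subrK (A *m Q)) mulmxDl -mulmxA.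
apply: le_trans (ler_norm2D _ _) _.
have H1 := opbound_frob (P - A *m Q) v.
have H2 := ler_wpM2r (norm2_ge0 v) E.
have H3 := fl_opbound HS (Q *m v).
have H4 := ler_wpM2l (ltW a0) (err_Q HE v).
lra.
Qed.

Lemma phi_ge0 : 0 <= phi.
Proof.
have [a0 _ mu0 _ _] := small_unit HS; have u0 := ltW (fl_u_gt0 HS); have a0' := ltW a0.
by rewrite !mulr_ge0 ?(err_y0 HE) ?(err_mu0 HE) ?sqrtr_ge0 // ltW.
Qed.

(* The matrix of partial inner products over a fixed set of rows is
   [triu (X^T Q) R] up to a small term, whence a Frobenius bound that gains
   [Num.sqrt n] over the entrywise one. *)
Lemma l2_partial_dots rho (B : pred 'I_m) : 0 <= rho -> opbound r rho ->
  l2 (fun p : 'I_n * 'I_n => \sum_(k | B k)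
        P k p.1 * (if (p.1 < p.2)%N then z p.2 p.1 k 0 else 0))
    <= h * al * y * mu * (4 * rho + S).
Proof.
move=> rho0 rhoP.
have [a0 _ mu0 _ _] := small_unit HS; have u0 := ltW (fl_u_gt0 HS); have a0' := ltW a0.
have y0 := err_y0 HE; have mu_ge0 := err_mu0 HE; have S0 := ltW S_gt0.
have aly : 0 <= 2 * al * y by rewrite !mulr_ge0 // ltW.
pose X (i : 'I_n) : 'cV[R]_m := \col_k (if B k then P k i else 0).
have XP i : norm2 (X i) <= 2 * al * y.
  apply: le_trans (norm2_col i opboundP); rewrite !norm2E.
  rewrite (eq_l2 (g := fun k => if B k then col i P k 0 else 0)); first exact: l2_mask.
  by move=> k; rewrite !mxE.
rewrite (eq_l2 (g := fun p : 'I_n * 'I_n =>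
    if (p.1 < p.2)%N then dot (X p.1) (z p.2 p.1) else 0)); last first.
  move=> p; case: ifP => _; last by rewrite big1 // => k _; rewrite mulr0.
  by rewrite /dot big_mkcond; apply: eq_bigr => k _; rewrite mxE; case: (B k); rewrite ?mul0r.
apply: le_trans (l2_mask (fun p : 'I_n * 'I_n => dot (X p.1) (z p.2 p.1))
  (fun p : 'I_n * 'I_n => (p.1 < p.2)%N)) _.
rewrite (eq_l2 (g := fun p : 'I_n * 'I_n => dot (X p.1) (tail_vec p.2 p.1)
    + - dot (X p.1) (tail_err p.2 p.1))); last first.
  by move=> p; rewrite (z_tail _ (ltnW (ltn_ord p.1))) dotDr dotNr.
apply: le_trans (ler_l2D _ _) _.
(* Column [l] is [P^T] applied to a masked copy of [q l]: the operator norm of [P] is used once for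
   all [i], and only the number of columns costs a factor [h]. *)
have H1 : l2 (fun p : 'I_n * 'I_n => dot (X p.1) (q p.2)) <= h * (2 * al * y * (2 * mu)).
  apply: le_trans (l2_pairr (g := fun=> 2 * al * y * (2 * mu)) _) _ => [l|]; last first.
    apply: l2_const_n => [i|]; last by rewrite !mulr_ge0.
    by rewrite ger0_norm ?lexx // !mulr_ge0.
  pose w : 'cV[R]_m := \col_k (if B k then q l k 0 else 0).
  have -> : l2 (fun i => dot (X i) (q l)) = l2 (fun i => dot (col i P) w).
    apply: eq_l2 => i; apply: eq_bigr => k _; rewrite !mxE.
    by case: (B k); rewrite ?mul0r ?mulr0.
  apply: le_trans (l2_dot_cols w aly opboundP) _; rewrite ler_wpM2l //.
  apply: le_trans (err_q HE l); rewrite !norm2E.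
  rewrite (eq_l2 (g := fun k => if B k then q l k 0 else 0)); first exact: l2_mask.
  by move=> k; rewrite mxE.
have H2 := le_trans (l2_dot_tail X rho0 rhoP) (ler_wpM2l rho0 H1).
have te0 : 0 <= 18 * (m%:R * u) * mu * S by rewrite !mulr_ge0 // ltW.
have H3 : l2 (fun p : 'I_n * 'I_n => - dot (X p.1) (tail_err p.2 p.1))
    <= m%:R * (2 * al * y * (18 * (m%:R * u) * mu * S)).
  apply: l2_const_nn => [p|]; last by rewrite mulr_ge0.
  rewrite normrN; apply: le_trans (cauchy_dot _ _) _.
  by rewrite ler_pM ?norm2_ge0 // norm2_tail_err.
apply: le_trans (lerD H2 H3) _.
have [t0 _ _ _] := tau_bounds; have ts := tau_small.
have c0 : 0 <= al * y * mu * S by rewrite !mulr_ge0 // ltW.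
have hc0 : 0 <= h * (al * y * mu * S) by rewrite mulr_ge0 ?sqrtr_ge0.
have := ler_wpM2r c0 m_omega_le.
have : 100 * 100 * 100 * tau * (h * (al * y * mu * S)) <= h * (al * y * mu * S).
  by rewrite ler_piMl.
lra.
Qed.

(** The errors are split by source. [fA] and [cB] come from [p] differing from [A q], tested on the
    two parts of [z_tail]; [fC] and [cD] are the first and second order of the inner products; [fE]
    is the normalization, on the diagonal only. They contribute 14 and 8 times [phi * rho], 2 and 30
    times [phi * S], and small terms. *)
Lemma l2_coef_err rho : 0 <= rho -> opbound r rho ->
  l2 (fun p : 'I_n * 'I_n => coef_err p.1 p.2) <= 34 * phi * (rho + S).
Proof.
move=> rho0 rhoP.
have [a0 _ mu0 _ _] := small_unit HS; have u0 := ltW (fl_u_gt0 HS); have a0' := ltW a0.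
have y0 := err_y0 HE; have mu_ge0 := err_mu0 HE; have S0 := ltW S_gt0.
have [t0 _ _ _] := tau_bounds; have ts := tau_small.
have mu1 : 2 * m%:R * u <= 1.
  by have [_ _ ] := small_eta HS; have := h_ge1; nra.
pose om := m%:R * u.
pose W (p : 'I_n * 'I_n) k := P k p.1 * (if (p.1 < p.2)%N then z p.2 p.1 k 0 else 0).
pose e (i : 'I_n) := col i P - A *m q i.
pose fA (p : 'I_n * 'I_n) := `|dot (e p.1) (tail_vec p.2 p.1)|.
pose cB := 7 * om * al * y * (18 * om * mu * S).
pose fC (p : 'I_n * 'I_n) := u * node_sums td (W p).
pose cD := 2 * om ^+ 2 * (2 * al * y * (2 * mu * S)).
pose cE := 15 * om * al * y * (2 * mu * S).
pose fE (p : 'I_n * 'I_n) := if p.1 == p.2 then cE else 0.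
have om0 : 0 <= om by exact: ltW.
have cB0 : 0 <= cB by rewrite !mulr_ge0 // ltW.
have cD0 : 0 <= cD by rewrite !mulr_ge0 ?sqr_ge0 // ltW.
have cE0 : 0 <= cE by rewrite !mulr_ge0 // ltW.
have fC0 p : 0 <= fC p by rewrite mulr_ge0 ?node_sums_ge0.
have fE0 p : 0 <= fE p by rewrite /fE; case: ifP.
have pointwise (p : 'I_n * 'I_n) :
    `|coef_err p.1 p.2| <= fA p + (cB + (fC p + (cD + fE p))).
  case: p => i j /=; have := normr_ge0 (dot (e i) (tail_vec j i)).
  move=> fA0; have fC0' := fC0 (i, j); have fE0' := fE0 (i, j).
  have [lt_ij|lt_ji|eq_ij] := ltngtP i j.
  - have -> : coef_err i j = (r i j - dot (col i P) (z j i))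
        + (dot (e i) (tail_vec j i) - dot (e i) (tail_err j i)).
      have <- : dot (e i) (z j i) = dot (e i) (tail_vec j i) - dot (e i) (tail_err j i).
        by rewrite (z_tail _ (ltnW (ltn_ord i))) dotDr dotNr.
      rewrite /coef_err.
      by rewrite /e dotDl dotNl [dot (A *m q i) _]dotC (dotAC (fl_sym HS) (z j i)); ring.
    have H1 : `|r i j - dot (col i P) (z j i)| <= fC (i, j) + cD.
      apply: le_trans (err_dot HE lt_ij) _; rewrite /fC /W /= lt_ij lerD2l.
      have -> : cD = 2 * m%:R ^+ 2 * u ^+ 2 * (2 * al * y * (2 * mu * S)).
        by rewrite /cD /om; ring.
      rewrite ler_wpM2l //; first by rewrite !mulr_ge0 ?sqr_ge0.
      by rewrite ler_pM ?norm2_ge0 ?norm2_z // norm2_col //; exact: opboundP.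
    have H2 : `|dot (e i) (tail_err j i)| <= cB.
      apply: le_trans (cauchy_dot _ _) _; have [H _] := norm2_err_p i.
      by rewrite ler_pM ?norm2_ge0 // norm2_tail_err.
    apply: le_trans (ler_normD _ _) _.
    apply: le_trans (lerD H1 (ler_normB _ _)) _.
    by rewrite /fA /=; move: H2 fE0'; clear; lra.
  - have [_ zij] := err_low HE lt_ji.
    by rewrite /coef_err (err_low HE lt_ji).1 zij mulmx0 dot0r subrr normr0 !addr_ge0 //.
  - have -> : j = i by apply/val_inj.
    have H : `|coef_err i i| <= cE.
      apply: le_trans (err_diag HE i) _.
      rewrite /cE ler_pM ?norm2_ge0 ?norm2_z ?mulr_ge0 ?norm2_ge0 ?(ltW a0) //.
      by rewrite ler_wpM2l ?norm2_q_y // !mulr_ge0 // ltW.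
    have := normr_ge0 (dot (e i) (tail_vec i i)); have := fC0 (i, i).
    by rewrite /fE eqxx /fA /=; move: H cB0 cD0; clear; lra.
apply: le_trans (ler_l2 pointwise) _.
apply: le_trans (ler_l2D _ _) _.
apply: le_trans (lerD (lexx _) (ler_l2D _ _)) _.
apply: le_trans (lerD (lexx _) (lerD (lexx _) (ler_l2D _ _))) _.
apply: le_trans (lerD (lexx _) (lerD (lexx _) (lerD (lexx _) (ler_l2D _ _)))) _.
(* Row [i] is now [Q^T] applied to [e i], which gives the factor [y], while the length of [e i]
   gives the factor [mu]. *)
have HA : l2 fA <= 14 * phi * rho.
  rewrite l2_norm; apply: le_trans (l2_dot_tail e rho0 rhoP) _.
  rewrite mulrC ler_wpM2r //.
  apply: le_trans (l2_pairl (g := fun=> y * (14 * om * al * mu)) _) _ => [i|].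
    rewrite /= (eq_l2 (g := fun l => dot (q l) (e i))); last by move=> l; rewrite dotC.
    apply: le_trans (l2_dot_cols (e i) y0 (err_Q HE)) _; rewrite ler_wpM2l //.
    by have [] := norm2_err_p i.
  have c0 : 0 <= y * (14 * om * al * mu) by rewrite !mulr_ge0 // ltW.
  apply: le_trans (l2_const_n (c := y * (14 * om * al * mu)) _ c0) _ => [i|].
    by rewrite ger0_norm.
  by rewrite /om le_eqVlt; apply/orP; left; apply/eqP; ring.
have c0 : 0 <= om * (al * y * mu * S) by rewrite !mulr_ge0 // ltW.
have mtau := ler_wpM2r c0 m_omega_le.
have tauc : 100 * 100 * 100 * tau * (h * (om * (al * y * mu * S)))
    <= h * (om * (al * y * mu * S)).
  by rewrite ler_piMl // mulr_ge0 ?sqrtr_ge0.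
have HB : l2 (fun _ : 'I_n * 'I_n => cB) <= m%:R * cB.
  by apply: l2_const_nn => // p; rewrite ger0_norm.
have HD : l2 (fun _ : 'I_n * 'I_n => cD) <= m%:R * cD.
  by apply: l2_const_nn => // p; rewrite ger0_norm.
have HC : l2 fC <= phi * (8 * rho + 2 * S).
  rewrite l2Z (ger0_norm u0).
  apply: le_trans (ler_wpM2l u0 (l2_node_sums (complete_uniq (fl_td HS))
    (fun B => l2_partial_dots B rho0 rhoP))) _.
  rewrite (complete_size (fl_td HS)).
  by rewrite le_eqVlt; apply/orP; left; apply/eqP; ring.
have HEd : l2 fE <= h * cE.
  apply: le_trans (l2_pairl (g := fun=> cE) _) _ => [i|]; last first.
    by apply: l2_const_n => // i; rewrite ger0_norm.
  apply: l2_le_sqr => //; rewrite (bigD1 i) //= big1 => [|j ji].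
    by rewrite /fE eqxx addr0.
  by rewrite /fE /= eq_sym (negPf ji) expr0n.
apply: le_trans (lerD HA (lerD HB (lerD HC (lerD HD HEd)))) _.
have phi0 : 0 <= phi * rho by rewrite mulr_ge0 ?phi_ge0.
have phiS : 0 <= phi * S by rewrite mulr_ge0 ?phi_ge0.
move: mtau tauc phi0 phiS; rewrite /cB /cD /cE /om => *; lra.
Qed.

(** * Energy of a linear combination of the columns *)

Section Combination.
Variable v : 'cV[R]_n.

Definition comb_z (i : nat) := \sum_j v j 0 *: z j i.
Definition comb_upd (i : 'I_n) := \sum_j v j 0 *: upd_err i j.
Definition comb_coef (i : 'I_n) := \sum_j coef_err i j * v j 0.
Local Notation rv i := ((r *m v) i 0).
Local Notation step_err := (18 * (u * (al / la)) * S * h * norm2 v).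
Local Notation total_err := (18 * tau * S * norm2 v).

Lemma comb_zS (i : 'I_n) : comb_z i.+1 = (comb_z i - rv i *: q i) + comb_upd i.
Proof.
rewrite mxE scaler_suml -sumrB -big_split /=; apply: eq_bigr => j _.
by rewrite /upd_err; apply/matrixP => a b; rewrite !mxE; ring.
Qed.

Lemma comb_coefE (i : 'I_n) : rv i - dot (q i) (A *m comb_z i) = comb_coef i.
Proof.
rewrite mulmx_sumr dot_sumr mxE -sumrB; apply: eq_bigr => j _.
by rewrite -scalemxAr dotZr /coef_err; ring.
Qed.

Lemma comb_unit i : rv i = 0 \/ `|normA A (q i) ^+ 2 - 1| <= 14 * eta.
Proof.
case: (err_unit HE i) => [ri|]; [left | by right].
by rewrite mxE big1 // => j _; rewrite ri mul0r.
Qed.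

Lemma sum_norm_le : \sum_j `|v j 0| <= h * norm2 v.
Proof.
have := cauchy_sum (fun j => `|v j 0|) (fun=> 1).
rewrite l2_norm -norm2E => /(le_trans (ler_norm _)).
under eq_bigr do rewrite mulr1.
move=> /le_trans; apply; rewrite mulrC ler_wpM2r ?norm2_ge0 //.
by apply: le_trans (l2_const_n (c := 1) _ _) _ => // [i|]; rewrite ?normr1 ?mulr1.
Qed.

Lemma step_err_ge0 : 0 <= step_err.
Proof.
have u0 := ltW (fl_u_gt0 HS); have a0 := ltW al_gt0; have l0 := ltW (fl_la_gt0 HS).
by have S0 := ltW S_gt0; rewrite !mulr_ge0 ?invr_ge0 ?norm2_ge0 ?sqrtr_ge0.
Qed.

Lemma step_err_total : n%:R * step_err <= total_err.
Proof.
apply: le_trans (ler_wpM2r step_err_ge0 n_le_m) _.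
by rewrite (fl_eta HS) le_eqVlt; apply/orP; left; apply/eqP; ring.
Qed.

Lemma normA_comb_upd i : normA A (comb_upd i) <= step_err.
Proof.
apply: le_trans (ler_normA_sum (fl_sym HS) (psdA HS) _ _ _) _.
have u0 := ltW (fl_u_gt0 HS); have a0 := ltW al_gt0; have l0 := ltW (fl_la_gt0 HS).
have k0 : 0 <= 9 * (u * (al / la)) by rewrite !mulr_ge0 ?invr_ge0.
apply: (@le_trans _ _ (\sum_j `|v j 0| * (9 * (u * (al / la)) * (2 * S)))).
  apply: ler_sum => j _; rewrite normAZ // ler_wpM2l //.
  apply: le_trans (normA_upd_err i j) _; rewrite ler_wpM2l //.
  exact: normA_z (ltnW (ltn_ord i)).
rewrite -mulr_suml.
have c0 : 0 <= 9 * (u * (al / la)) * (2 * S).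
  by rewrite mulr_ge0 // mulr_ge0 // ltW // S_gt0.
by apply: le_trans (ler_wpM2r c0 sum_norm_le) _; rewrite le_eqVlt; apply/orP; left; apply/eqP; ring.
Qed.

Lemma comb_z0 : comb_z 0 = Z *m v.
Proof. by rewrite mulmx_sum_cols; apply: eq_bigr => j _; rewrite (err_init HE). Qed.

Lemma comb_zn : comb_z n = 0.
Proof. by rewrite /comb_z big1 // => j _; rewrite (err_end HE) scaler0. Qed.

Local Notation a0 := (normA A (Z *m v)).
Local Notation e := (l2 comb_coef).

Lemma sqrt_add_sqr (x d c : R) : 0 <= x -> 0 <= d -> 0 <= c ->
  (Num.sqrt x + d) ^+ 2 + c <= (Num.sqrt (x + c) + d) ^+ 2.
Proof.
move=> x0 d0 c0; rewrite !sqrrD !sqr_sqrtr ?addr_ge0 //.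
have : Num.sqrt x * d <= Num.sqrt (x + c) * d.
  by rewrite ler_wpM2r // ler_wsqrtr // lerDl.
lra.
Qed.

(** Coefficient errors accumulate in squares, hence under the root; update errors accumulate
    linearly, hence outside. [sqrt_add_sqr] moves each new square under the root. *)
Lemma normA_comb_z_sqrt (i : nat) : (i <= n)%N ->
  normA A (comb_z i) <=
    Num.sqrt (a0 ^+ 2 + 2 * \sum_(l < n | (l < i)%N) comb_coef l ^+ 2) + i%:R * step_err.
Proof.
elim: i => [|i IH] lt_in.
  rewrite big_pred0 // mulr0 addr0 mul0r addr0 comb_z0 sqrtr_sqr.
  by rewrite ger0_norm ?normA_ge0.
have {}IH := IH (ltnW lt_in); pose k := Ordinal lt_in.
rewrite (comb_zS k).
apply: le_trans (ler_normAD (fl_sym HS) (psdA HS) _ _) _.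
rewrite -[i.+1%:R]natr1 [(i%:R + 1) * _]mulrDl mul1r addrA lerD ?normA_comb_upd //.
have D0 := step_err_ge0.
have ge0 : 0 <= a0 ^+ 2 + 2 * \sum_(l < n | (l < i)%N) comb_coef l ^+ 2.
  by rewrite addr_ge0 ?sqr_ge0 // mulr_ge0 // sumr_ge0 // => l _; rewrite sqr_ge0.
apply: ler_sqr_abs; first by rewrite addr_ge0 ?sqrtr_ge0 // mulr_ge0.
apply: le_trans (project_energy_le _ (comb_unit k)) _.
rewrite comb_coefE (head_sum_recr (fun l => comb_coef l ^+ 2) k) /= [2 * (_ + _)]mulrDr addrA.
have id0 : 0 <= i%:R * step_err by rewrite mulr_ge0.
have c0 : 0 <= 2 * comb_coef k ^+ 2 by rewrite mulr_ge0 ?sqr_ge0.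
apply: le_trans (sqrt_add_sqr ge0 id0 c0).
have rhs0 : 0 <= Num.sqrt (a0 ^+ 2 + 2 * \sum_(l < n | (l < i)%N) comb_coef l ^+ 2)
    + i%:R * step_err by rewrite addr_ge0 ?sqrtr_ge0.
by rewrite lerD2r ler_pXn2r ?nnegrE ?normA_ge0.
Qed.

Lemma normA_comb_z (i : nat) : (i <= n)%N ->
  normA A (comb_z i) <= a0 + 2 * e + total_err.
Proof.
move=> le_in; apply: le_trans (normA_comb_z_sqrt le_in) _; apply: lerD.
  have ge0 : 0 <= a0 ^+ 2 + 2 * \sum_(l < n | (l < i)%N) comb_coef l ^+ 2.
    by rewrite addr_ge0 ?sqr_ge0 // mulr_ge0 // sumr_ge0 // => l _; rewrite sqr_ge0.
  have a00 := normA_ge0 A (Z *m v); have e0 := l2_ge0 comb_coef.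
  apply: ler_sqr_abs; first by rewrite addr_ge0 // mulr_ge0.
  rewrite (sqr_sqrtr ge0).
  have : \sum_(l < n | (l < i)%N) comb_coef l ^+ 2 <= e ^+ 2.
    rewrite sqr_l2 big_mkcond; apply: ler_sum => l _; case: ifP => // _; exact: sqr_ge0.
  by have := mulr_ge0 a00 e0; have := sqr_ge0 e; rewrite sqrrD; lra.
apply: le_trans step_err_total; rewrite ler_wpM2r ?step_err_ge0 //.
by rewrite ler_nat.
Qed.

(** The exact balance, summed over the steps. Each update error is expanded around the vector after
    the step, whose energy [normA_comb_z] bounds. *)
Lemma comb_energy (i : nat) : (i <= n)%N ->
  normA A (comb_z i) ^+ 2 = a0 ^+ 2 + \sum_(l < n | (l < i)%N)
    (- rv l ^+ 2 + 2 * rv l * comb_coef l + rv l ^+ 2 * (normA A (q l) ^+ 2 - 1)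
     + 2 * dot (comb_z l.+1) (A *m comb_upd l) - normA A (comb_upd l) ^+ 2).
Proof.
elim: i => [|i IH] lt_in; first by rewrite big_pred0 // addr0 comb_z0.
have {}IH := IH (ltnW lt_in); pose k := Ordinal lt_in.
pose F (l : 'I_n) := - rv l ^+ 2 + 2 * rv l * comb_coef l
  + rv l ^+ 2 * (normA A (q l) ^+ 2 - 1)
  + 2 * dot (comb_z l.+1) (A *m comb_upd l) - normA A (comb_upd l) ^+ 2.
rewrite (head_sum_recr F k) addrA -IH /F /=.
have wE : comb_z i - rv k *: q k = comb_z i.+1 - comb_upd k by rewrite (comb_zS k) addrK.
have := project_energy k (comb_z i) (rv k); rewrite (comb_coefE k) wE.
rewrite -[- comb_upd k]scaleN1r sqr_normAD ?(fl_sym HS) //; last exact: (psdA HS).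
by rewrite -scalemxAr dotZr normAZ // normrN1 => ?; lra.
Qed.

(** After [n] steps the combination is zero, so the whole energy of [Z *m v] has gone into the
    square of [norm2 (r *m v)], up to the defects. *)
Lemma energy_balance :
  `|norm2 (r *m v) ^+ 2 - a0 ^+ 2| <= 2 * norm2 (r *m v) * e
    + 14 * eta * norm2 (r *m v) ^+ 2
    + 2 * total_err * (a0 + 2 * e + total_err) + total_err ^+ 2.
Proof.
have := comb_energy (leqnn n); rewrite comb_zn normA0 // expr0n /=.
rewrite (eq_bigl xpredT) => [|l]; last by rewrite ltn_ord.
rewrite sumrB !big_split /= sumrN.
have N2 : norm2 (r *m v) ^+ 2 = \sum_l rv l ^+ 2 by rewrite norm2E sqr_l2.
rewrite -N2; set N := norm2 _ in N2 *.
set T := total_err; set B := a0 + 2 * e + T.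
have D0 := step_err_ge0; have DT := step_err_total.
have n0 : (1 : R) <= n%:R by rewrite ler1n; have /andP [] := err_n HE.
have B0 : 0 <= B := le_trans (normA_ge0 _ _) (normA_comb_z (leq0n n)).
have H1 : `|\sum_l 2 * rv l * comb_coef l| <= 2 * N * e.
  under eq_bigr do rewrite -mulrA; rewrite -mulr_sumr normrM ger0_norm // -mulrA.
  by rewrite ler_wpM2l // /N norm2E; exact: cauchy_sum.
have H2 : `|\sum_l rv l ^+ 2 * (normA A (q l) ^+ 2 - 1)| <= 14 * eta * N ^+ 2.
  apply: le_trans (ler_norm_sum _ _ _) _; rewrite N2 mulr_sumr; apply: ler_sum => l _.
  rewrite normrM (ger0_norm (sqr_ge0 _)) mulrC.
  case: (comb_unit l) => [->|H]; first by rewrite expr0n !mulr0.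
  by rewrite ler_wpM2r ?sqr_ge0.
have H3 : `|\sum_(l < n) 2 * dot (comb_z l.+1) (A *m comb_upd l)| <= 2 * T * B.
  rewrite -mulr_sumr normrM ger0_norm // -mulrA ler_wpM2l //.
  apply: le_trans (ler_norm_sum _ _ _) _.
  apply: (@le_trans _ _ (\sum_(l < n) B * step_err)).
    apply: ler_sum => l _; apply: le_trans (cauchyA (fl_sym HS) (psdA HS) _ _) _.
    by rewrite ler_pM ?normA_ge0 ?normA_comb_upd // normA_comb_z.
  rewrite sumr_const card_ord -[_ *+ n]mulr_natl mulrCA mulrC.
  by rewrite ler_wpM2r.
have H4 : 0 <= \sum_l normA A (comb_upd l) ^+ 2 <= T ^+ 2.
  apply/andP; split; first by apply: sumr_ge0 => l _; exact: sqr_ge0.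
  apply: (@le_trans _ _ (\sum_(l < n) step_err ^+ 2)).
    by apply: ler_sum => l _; rewrite ler_pXn2r ?nnegrE ?normA_ge0 // normA_comb_upd.
  rewrite sumr_const card_ord -[_ *+ n]mulr_natl.
  apply: (@le_trans _ _ ((n%:R * step_err) ^+ 2)); last first.
    have nD0 : 0 <= n%:R * step_err by rewrite mulr_ge0.
    by rewrite ler_pXn2r ?nnegrE // (le_trans nD0 DT).
  rewrite [(n%:R * _) ^+ 2]exprMn ler_wpM2r ?sqr_ge0 // [n%:R ^+ 2]expr2.
  by rewrite ler_peMl // (le_trans _ n0).
move: H1 H2 H3 H4.
move: (\sum_l 2 * rv l * comb_coef l) => s1.
move: (\sum_l rv l ^+ 2 * _) => s2.
move: (\sum_(l < n) 2 * dot (comb_z l.+1) _) => s3.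
move: (\sum_l normA A _ ^+ 2) => s4.
rewrite !ler_norml => /andP [? ?] /andP [? ?] /andP [? ?] /andP [? ?] ?.
by apply/andP; split; lra.
Qed.

Lemma l2_comb_coef rho : 0 <= rho -> opbound r rho ->
  e <= 34 * phi * (rho + S) * norm2 v.
Proof.
move=> rho0 rhoP; pose C := \matrix_(i, j) coef_err i j.
have -> : e = norm2 (C *m v).
  rewrite norm2E; apply: eq_l2 => i; rewrite mxE.
  by apply: eq_bigr => j _; rewrite mxE.
apply: le_trans (opbound_frob C v) _; rewrite ler_wpM2r ?norm2_ge0 //.
apply: le_trans (l2_coef_err rho0 rhoP).
by rewrite le_eqVlt; apply/orP; left; apply/eqP/eq_l2 => p; rewrite mxE.
Qed.

End Combination.

(** * Bounds on the triangular factor and its inverse *)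

Lemma phi_tau : phi <= 4 * tau.
Proof.
have [a0 _ mu0 _ mual] := small_unit HS; have l0 := fl_la_gt0 HS.
rewrite -(ler_pM2r l0).
have c0 : 0 <= m%:R * u * h * al.
  by rewrite !mulr_ge0 ?sqrtr_ge0 // ltW // (fl_u_gt0 HS).
have := ler_wpM2l c0 (err_ymu HE).
have -> : 4 * tau * la = h * (4 * (eta * la)) by ring.
by rewrite -mual; lra.
Qed.

Lemma upper_bound_of_balance (N a e t X k : R) :
  0 <= N -> 0 <= a -> 0 <= e -> 0 <= t -> a <= X -> 100 * t <= X -> 0 <= k -> 100 * k <= 1 ->
  `|N ^+ 2 - a ^+ 2| <= 2 * N * e + k * N ^+ 2 + 2 * t * (a + 2 * e + t) + t ^+ 2 ->
  N <= 3 / 2 * X + 3 * e.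
Proof.
move=> N0 a0 e0 t0 aX tX k0 k1 /ler_normlP [_ H].
rewrite leNgt; apply/negP; set B := _ + _ => BN.
have X0 : 0 <= X := le_trans a0 aX.
have kN : k * N ^+ 2 <= 1 / 100 * N ^+ 2 by rewrite ler_wpM2r ?sqr_ge0 //; lra.
have aX2 : a ^+ 2 <= X ^+ 2 by rewrite ler_pXn2r ?nnegrE.
have tX2 : t * (2 * (a + 2 * e + t) + t) <= X / 100 * (2 * (X + 2 * e + X) + X).
  by rewrite ler_pM //; lra.
(* Were [N > B], both factors would be positive, and the expanded product contradicts the
   balance. *)
have NB : 0 < (N - B) * (99 / 100 * (N + B) - 2 * e).
  by rewrite /B in BN *; apply: mulr_gt0; lra.
have XX : 0 <= X * X by rewrite mulr_ge0.
have Xe : 0 <= X * e by rewrite mulr_ge0.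
have ee : 0 <= e * e by rewrite mulr_ge0.
by rewrite /B in NB; lra.
Qed.

Lemma lower_bound_of_balance (N a e t k : R) :
  0 <= N -> 0 <= a -> 0 <= e -> 0 <= t -> 100 * e <= a -> 100 * t <= a -> 0 <= k -> 100 * k <= 1 ->
  `|N ^+ 2 - a ^+ 2| <= 2 * N * e + k * N ^+ 2 + 2 * t * (a + 2 * e + t) + t ^+ 2 ->
  a <= 2 * N.
Proof.
move=> N0 a0 e0 t0 ea ta k0 k1 /ler_normlP [H _].
rewrite leNgt; apply/negP => Na.
have kN : k * N ^+ 2 <= 1 / 100 * N ^+ 2 by rewrite ler_wpM2r ?sqr_ge0 //; lra.
have t2 : t * (2 * (a + 2 * e + t) + t) <= a / 100 * (2 * (a + a + a) + a).
  by rewrite ler_pM //; lra.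
have Ne : N * e <= a * (a / 100) by rewrite ler_pM //; lra.
have N2 : N * N <= (a / 2) * (a / 2) by rewrite ler_pM //; lra.
have aa : 0 < a * a by rewrite mulr_gt0; lra.
lra.
Qed.

Lemma eta14 : 0 <= 14 * eta /\ 100 * (14 * eta) <= 1.
Proof.
have [t0 et _ _] := tau_bounds; have ts := tau_small; have e0 := eta_gt0.
by split; lra.
Qed.

Lemma total_err_le (v : 'cV[R]_n) : 0 <= 18 * tau * S * norm2 v /\
  100 * 100 * (18 * tau * S * norm2 v) <= sg * norm2 v.
Proof.
have [t0 _ _ _] := tau_bounds; have S0 := S_gt0; have v0 := norm2_ge0 v.
have tS : 0 <= tau * S * norm2 v := mulr_ge0 (mulr_ge0 (ltW t0) (ltW S0)) v0.
have := ler_wpM2r v0 (err_small HE); split; lra.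
Qed.

(** The errors in the balance are themselves bounded through the norm [rho] of [r]. As their
    coefficient is small, this gives [rho <= 3 / 2 * S + 1 / 10 * (rho + S)], which is solved for
    [rho]. *)
Lemma opbound_r : opbound r (2 * S).
Proof.
have [t0 et _ _] := tau_bounds; have ts := tau_small; have S0 := S_gt0.
have n0 : (0 < n)%N by have /andP [] := err_n HE.
have rho0 : 0 <= specnorm r := specnorm_ge0 r n0.
have [k0 k1] := eta14.
set rho := specnorm r in rho0.
have rhoP : opbound r rho := specnormP r n0.
have phi_le : 100 * 100 * phi <= 1 by have := phi_tau; lra.
have H : opbound r (3 / 2 * S + 1 / 10 * (rho + S)).
  move=> v; have v0 := norm2_ge0 v; have [T0 T1] := total_err_le v.
  have e1 := l2_comb_coef v rho0 rhoP.
  have rSv : 0 <= (rho + S) * norm2 v by rewrite mulr_ge0 // addr_ge0 // ltW.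
  have ub : 100 * (18 * tau * S * norm2 v) <= S * norm2 v.
    have := ler_wpM2r v0 (err_sgS HE); lra.
  have := upper_bound_of_balance (norm2_ge0 (r *m v)) (normA_ge0 A (Z *m v))
    (l2_ge0 _) T0 (err_Zup HE v) ub k0 k1 (energy_balance v).
  have : 100 * 100 * phi * ((rho + S) * norm2 v) <= (rho + S) * norm2 v.
    by rewrite ler_piMl.
  move: e1; move: (phi) => p e1 H1 H2.
  by apply: le_trans H2 _; lra.
have := specnorm_le n0 H; rewrite -/rho => rho_le.
by apply: opbound_le rhoP; lra.
Qed.

(** The errors are small multiples of [S * norm2 v]; [err_small] makes them small against
    [sg * norm2 v], hence against the energy of [Z *m v]. *)
Lemma r_lower (v : 'cV[R]_n) : sg * norm2 v <= 2 * norm2 (r *m v).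
Proof.
have S0 := S_gt0; have [k0 k1] := eta14; have [T0 T1] := total_err_le v.
have Zlo := err_Zlo HE v; have v0 := norm2_ge0 v.
have S20 : 0 <= 2 * S by rewrite mulr_ge0 // ltW.
have e1 := l2_comb_coef v S20 opbound_r.
apply: (le_trans Zlo).
have Sv : 0 <= S * norm2 v by rewrite mulr_ge0 // ltW.
have pt := ler_wpM2r Sv phi_tau.
have small := ler_wpM2r v0 (err_small HE).
have sv : 0 <= sg * norm2 v by rewrite mulr_ge0 // ltW // (err_sg HE).
apply: (lower_bound_of_balance _ (normA_ge0 _ _) (l2_ge0 _) T0 _ _ k0 k1 (energy_balance v)).
- exact: norm2_ge0.
- by lra.
- by lra.
Qed.

(** The lower bound leaves no kernel. In particular no breakdown occurred, since it would produce a
    zero row. *)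
Lemma r_unit : r \in unitmx.
Proof.
rewrite -unitmx_tr unitmxE unitfE; apply/negP => /det0P [v v_neq0 vr].
have := r_lower v^T.
have -> : r *m v^T = 0 by rewrite -[r]trmxK -trmx_mul vr trmx0.
rewrite norm20 mulr0 pmulr_rle0 ?(err_sg HE) // => v0.
have : v^T == 0 by rewrite -norm2_eq0 eq_le v0 norm2_ge0.
by rewrite -[0]trmx0 (inj_eq (@trmx_inj _ _ _)) (negPf v_neq0).
Qed.

(** * The upper triangle of the Gram matrix *)

Definition upper_gram : 'M[R]_n :=
  \matrix_(i, l) (if (i <= l)%N then dot (q i) (A *m q l) else 0) - 1%:M.
Definition upper_res : 'M[R]_n :=
  \matrix_(i, j) (- coef_err i j + dot (q i) (A *m tail_err j i)).

(** By [z_tail], multiplying the triangle of the Gram matrix by [r] gives [q_i^T A] applied to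
    [z j i + tail_err j i]; the first part is [r i j] minus its error, and the identity cancels
    [r i j]. *)
Lemma upper_gramM : upper_gram *m r = upper_res.
Proof.
rewrite mulmxBl mul1mx; apply/matrixP => i j; rewrite !mxE.
rewrite (eq_bigr (fun l : 'I_n => if (i <= l)%N then r l j * dot (q i) (A *m q l) else 0)); last first.
  by move=> l _; rewrite mxE; case: ifP; rewrite ?mul0r // mulrC.
rewrite -big_mkcond /=.
have -> : \sum_(l < n | (i <= l)%N) r l j * dot (q i) (A *m q l)
  = dot (q i) (A *m tail_vec j i).
  rewrite /tail_vec mulmx_sumr dot_sumr; apply: eq_bigr => l _.
  by rewrite -scalemxAr dotZr.
have -> : tail_vec j i = z j i + tail_err j i.
  by rewrite (z_tail _ (ltnW (ltn_ord i))) subrK.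
by rewrite mulmxDr dotDr /coef_err; ring.
Qed.

Lemma frob_upper_res : frob upper_res <= 120 * phi * S.
Proof.
have [a0 _ mu0 _ _] := small_unit HS; have u0 := ltW (fl_u_gt0 HS); have a0' := ltW a0.
have y0 := err_y0 HE; have mu_ge0 := err_mu0 HE; have S0 := ltW S_gt0.
have S20 : 0 <= 2 * S by rewrite mulr_ge0.
rewrite /frob (eq_l2 (g := fun p : 'I_n * 'I_n => - coef_err p.1 p.2
  + dot (q p.1) (A *m tail_err p.2 p.1))); last by move=> p; rewrite mxE.
apply: le_trans (ler_l2D _ _) _.
have -> : l2 (fun p : 'I_n * 'I_n => - coef_err p.1 p.2)
        = l2 (fun p : 'I_n * 'I_n => coef_err p.1 p.2).
  by rewrite -[LHS]l2_norm -[RHS]l2_norm; apply: eq_l2 => p; rewrite normrN.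
have H1 := l2_coef_err S20 opbound_r.
pose c := y * (al * (18 * u * mu * S)).
have c0 : 0 <= c by rewrite !mulr_ge0.
(* The sum over [l] is taken outside the norm: for fixed [l], column [j] is part of [Q^T] applied to
   a single vector, so the bound [y] on [Q] serves all rows at once. *)
have H2 : l2 (fun p : 'I_n * 'I_n => dot (q p.1) (A *m tail_err p.2 p.1)) <= n%:R * (h * c).
  rewrite (eq_l2 (g := fun p : 'I_n * 'I_n => \sum_(l < n)
    (if (p.1 <= l)%N then dot (q p.1) (A *m upd_err l p.2) else 0))); last first.
    by move=> p; rewrite /tail_err mulmx_sumr dot_sumr big_mkcond.
  apply: le_trans (ler_l2_sum _ _) _.
  apply: (@le_trans _ _ (\sum_(l < n) h * c)); last first.
    by rewrite sumr_const card_ord -[_ *+ n]mulr_natl.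
  apply: ler_sum => l _.
  apply: le_trans (l2_mask (fun p : 'I_n * 'I_n => dot (q p.1) (A *m upd_err l p.2))
    (fun p : 'I_n * 'I_n => (p.1 <= l)%N)) _.
  apply: le_trans (l2_pairr (g := fun=> c) _) _ => [j|]; last first.
    by apply: l2_const_n => // i; rewrite ger0_norm.
  rewrite /=; apply: (le_trans (l2_dot_cols (A *m upd_err l j) y0 (err_Q HE))).
  rewrite ler_wpM2l //; apply: le_trans (fl_opbound HS _) _; rewrite ler_wpM2l //; exact: norm2_upd_err.
have hc0 : 0 <= h * c by rewrite mulr_ge0 ?sqrtr_ge0.
have := ler_wpM2r hc0 n_le_m.
have phiS : 0 <= phi * S by rewrite mulr_ge0 ?phi_ge0.
have -> : m%:R * (h * c) = 18 * phi * S by rewrite /c; ring.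
lra.
Qed.

Lemma opbound_upper_gram : opbound upper_gram (240 * phi * (S / sg)).
Proof.
move=> w; set v := invmx r *m w.
have vw : r *m v = w by rewrite mulmxA mulmxV ?r_unit // mul1mx.
have -> : upper_gram *m w = upper_res *m v by rewrite -vw mulmxA upper_gramM.
apply: le_trans (opbound_frob _ v) _.
apply: le_trans (ler_wpM2r (norm2_ge0 v) frob_upper_res) _.
have sg0 := err_sg HE.
have := r_lower v; rewrite vw mulrC -ler_pdivlMr // => vle.
have c0 : 0 <= 120 * phi * S.
  by apply: mulr_ge0; [apply: mulr_ge0 phi_ge0 | exact: ltW S_gt0].
have := ler_wpM2l c0 vle; move: (phi) => p H.
by apply: le_trans H _; rewrite le_eqVlt; apply/orP; left; apply/eqP; field; rewrite gt_eqF.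
Qed.

(** By symmetry the matrix is [W + W^T] minus the diagonal of [W], where [W] is [upper_gram]; each
    of the three is bounded by [c], whence 720 as 3 times 240. *)
Theorem loss_of_orthogonality :
  opbound (Q^T *m A *m Q - 1%:M) (720 * phi * (S / sg)).
Proof.
move=> w; set c := 240 * phi * (S / sg).
have c0 : 0 <= c.
  have S0 := ltW S_gt0; have sg0 := ltW (err_sg HE).
  by apply: mulr_ge0; [apply: mulr_ge0 phi_ge0 | apply: divr_ge0].
have Wc : opbound upper_gram c := opbound_upper_gram.
have GE i l : (Q^T *m A *m Q) i l = dot (q i) (A *m q l).
  rewrite -mulmxA mxE; apply: eq_bigr => k _.
  by rewrite !mxE; congr (_ * _); apply: eq_bigr => s _; rewrite !mxE.
have WE i l : upper_gram i l
    = (if (i <= l)%N then dot (q i) (A *m q l) else 0) - (i == l)%:R.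
  by rewrite /upper_gram !mxE.
move: upper_gram Wc WE => W Wc WE.
pose D : 'cV[R]_n := \col_i (W i i * w i 0).
have GW i l : (Q^T *m A *m Q - 1%:M) i l
    = W i l + W l i - (if l == i then W i i else 0).
  have -> : (Q^T *m A *m Q - 1%:M) i l = dot (q i) (A *m q l) - (i == l)%:R.
    by rewrite [LHS]mxE GE !mxE.
  rewrite !WE (dotAC (fl_sym HS) (q l) (q i)) leqnn eqxx [l == i]eq_sym.
  have [lt_il|lt_li|/val_inj <-] := ltngtP i l.
  - by rewrite -val_eqE /= (ltn_eqF lt_il) /= !mulr0n; ring.
  - by rewrite -val_eqE /= (gtn_eqF lt_li) /= !mulr0n; ring.
  - by rewrite eqxx /= !mulr1n; ring.
have -> : (Q^T *m A *m Q - 1%:M) *m w = W *m w + W^T *m w - D.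
  apply/matrixP => i j; rewrite ord1 [LHS]mxE.
  rewrite (eq_bigr (fun l => (W i l + W l i - (if l == i then W i i else 0)) * w l 0)).
    rewrite !mxE.
    have -> : W i i * w i 0 = \sum_l (if l == i then W i i else 0) * w l 0.
      rewrite (bigD1 i) //= eqxx big1 ?addr0 // => l li.
      by rewrite (negPf li) mul0r.
    by rewrite -big_split -sumrB; apply: eq_bigr => l _ /=; rewrite mxE mulrBl mulrDl.
  by move=> l _; rewrite GW.
apply: le_trans (ler_norm2B _ _) _; apply: le_trans (lerD (ler_norm2D _ _) (lexx _)) _.
have H1 := Wc w; have H2 := opbound_tr c0 Wc w.
have H3 : norm2 D <= c * norm2 w.
  rewrite -{1}(ger0_norm c0) !norm2E -l2Z -[leRHS]l2_norm.
  apply: ler_l2 => i; rewrite !mxE [leLHS]normrM [leRHS]normrM ler_wpM2r // (ger0_norm c0).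
  have := ler_norm_l2 (fun k => W k i) i; rewrite l2_col => H.
  exact: le_trans H (norm2_col i Wc).
have -> : 720 * phi * (S / sg) = c + c + c by rewrite /c; ring.
by rewrite !mulrDl; apply: lerD H3; apply: lerD.
Qed.

End ErrorAnalysis.

(** * Runs of the algorithm *)

Section Run.
Variables (R : realType) (m : nat) (A : 'M[R]_m) (al la u eta : R).
Variables (td tm : sum_order 'I_m).
Hypothesis HS : fl_setting A al la u eta td tm.

(** Implements the convention of [mgs_errors]: normalizing column [j] counts as its projection step
    [j], after which the column is zero. *)
Definition active n (z : 'I_n -> nat -> 'cV[R]_m) (j : 'I_n) (i : nat) :=
  if (i <= j)%N then z j i else 0.

Lemma double_mu_le1 : 2 * m%:R * u <= 1.
Proof.
have [_ _ hs] := small_eta HS; have := h_ge1 HS.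
have : 0 <= m%:R * u by rewrite mulr_ge0 // ltW // (fl_u_gt0 HS).
by move=> mu0 /(ler_wpM2l mu0); lra.
Qed.

Lemma fl_dot0 (p z : 'cV[R]_m) s : p = 0 -> fl_dot u td p z s -> s = 0.
Proof.
move=> -> /(fl_dot_error (ltW (fl_u_gt0 HS)) (fl_td HS) double_mu_le1).
by rewrite dot0l norm20 mul0r mulr0 subr0 normr_le0 => /eqP.
Qed.

Lemma eq_node_sums (I : Type) (t : sum_order I) (w w' : I -> R) :
  w =1 w' -> node_sums t w = node_sums t w'.
Proof.
move=> ww; elim: t => [k|l IHl r IHr] /=; first by rewrite ww.
by rewrite IHl IHr; congr (_ + `| _ |); apply: eq_bigr => k _; rewrite ww.
Qed.

Section Columns.
Variables (n : nat) (z : 'I_n -> nat -> 'cV[R]_m) (Z X P Q : 'M[R]_(m, n)) (Rh : 'M[R]_n).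
Hypothesis HR : mgs_ha_col u td tm A Z z X P Q Rh.

Lemma column_error (i : 'I_n) :
  ([/\ z i i = 0, col i Q = 0, col i P = 0 & Rh i i = 0] \/
   `|normA A (col i Q) ^+ 2 - 1| <= 14 * eta) /\
  [/\ norm2 (Rh i i *: col i Q - z i i) <= u * norm2 (z i i),
      norm2 (col i P - A *m col i Q) <= 7 * (m%:R * u) * al * norm2 (col i Q),
      forall mu, 0 <= mu -> norm2 (z i i) <= mu * normA A (z i i) ->
        norm2 (col i Q) <= 2 * mu &
      `|Rh i i - dot (col i Q) (A *m z i i)|
         <= 15 * (m%:R * u) * al * norm2 (col i Q) * norm2 (z i i)].
Proof.
have flx := mgs_mulA HR i; have [s fls flr] := mgs_diag HR i.
have flq := mgs_q HR i; have flp := mgs_p HR i.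
have [z0|z_neq0] := eqVneq (z i i) 0.
  move: (flx) (fls) (flq); rewrite z0 => flx0 fls0 flq0.
  have [r0 q0 p0] := normalize0 HS flx0 fls0 flr flq0 flp.
  split; first by left.
  rewrite r0 q0 p0 !(scale0r, mulmx0, subrr, norm20, mulr0, dot0l, normr0).
  by split=> // mu mu0 _; rewrite mulr_ge0.
have [e1 e2 e3 e4 e5] := normalize_error HS flx fls flr flq flp z_neq0.
by split; [right | split=> // mu _; exact: e3].
Qed.

Lemma column_cases (i : 'I_n) :
  col i Q = 0 \/ `|normA A (col i Q) ^+ 2 - 1| <= 14 * eta.
Proof. by case: (column_error i) => -[[_ q0 _ _]|H] _; [left | right]. Qed.

Lemma normA_column (i : 'I_n) : normA A (col i Q) <= 11 / 10.
Proof.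
have [e0 e1 _] := small_eta HS.
apply: ler_sqr_abs; first lra.
case: (column_cases i) => [->|]; first by rewrite normA0 expr0n /=; lra.
by rewrite ler_norml => /andP [_ H]; lra.
Qed.

(** The bounds [y] and [mu] are parameters because this is applied twice: with a priori values to
    bound the norm of [Q], then with [specnorm Q] and [mgs_mu A z]. *)
Lemma run_errors (y mu sg S : R) :
  (forall i j : 'I_n, (i <= j)%N -> norm2 (z j i) <= mu * normA A (z j i)) ->
  0 <= mu -> mu ^+ 2 * la <= 1 -> opbound Q y -> 0 <= y -> y * mu * la <= 4 ->
  (forall v, normA A (Z *m v) <= S * norm2 v) ->
  (forall v, sg * norm2 v <= normA A (Z *m v)) ->
  0 < sg -> sg <= S -> 100 * 100 * 100 * (Num.sqrt m%:R * eta * S) <= sg ->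
  (0 < n <= m)%N ->
  mgs_errors A al la u eta td y mu sg S Z P Q Rh (active z).
Proof.
move=> zmu mu0 mula Qy y0 ymu Zup Zlo sg0 sgS sm nm.
have u0 := fl_u_gt0 HS; have [eta0 eta1 _] := small_eta HS.
have low (i j : 'I_n) : (j < i)%N -> Rh i j = 0 /\ active z j i = 0.
  by move=> ji; rewrite /active leqNgt ji (mgs_lower HR ji).
have actE (i j : 'I_n) : (i <= j)%N -> active z j i = z j i by rewrite /active => ->.
have actS (i j : 'I_n) : (i < j)%N -> active z j i.+1 = z j i.+1 by rewrite /active => ->.
have act0 (i j : 'I_n) : (j <= i)%N -> active z j i.+1 = 0.
  by move=> ji; rewrite /active ltnNge ji.
have proj (i j : 'I_n) : (i < j)%N ->
    `|Rh i j - dot (col i Q) (A *m z j i)| <= 20 * eta * normA A (z j i) /\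
    norm2 (z j i.+1 - z j i + Rh i j *: col i Q) <= 9 * u * mu * normA A (z j i).
  move=> ij; have [_ [e1 e2 e3 e4]] := column_error i.
  have qmu := e3 mu mu0 (zmu i i (leqnn i)).
  have [H1 H2] := project_error HS e2 (column_cases i) qmu (zmu i j (ltnW ij))
    (mgs_offdiag HR ij).
  by split=> //; apply: H2; exact: mgs_update HR i j ij.
split=> //.
- by move=> j; rewrite /active leq0n (mgs_init HR).
- by move=> j; rewrite /active leqNgt ltn_ord.
- move=> i j; have [lt_ij|lt_ji|/val_inj eq_ij] := ltngtP i j.
  + by rewrite (actS _ _ lt_ij) (actE _ _ (ltnW lt_ij)); have [] := proj i j lt_ij.
  + have [-> ->] := low i j lt_ji; rewrite (act0 _ _ (ltnW lt_ji)).
    by rewrite subrr scale0r addr0 norm20 normA0 mulr0.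
  + rewrite -eq_ij (act0 _ _ (leqnn i)) (actE _ _ (leqnn i)) sub0r addrC.
    have [_ [e1 _ _ _]] := column_error i; apply: le_trans e1 _.
    have := ler_wpM2l (ltW u0) (zmu i i (leqnn i)).
    have := mulr_ge0 (ltW u0) (mulr_ge0 mu0 (normA_ge0 A (z i i))); lra.
- move=> i j; have [lt_ij|lt_ji|/val_inj eq_ij] := ltngtP i j.
  + by rewrite (actE _ _ (ltnW lt_ij)); have [] := proj i j lt_ij.
  + have [-> ->] := low i j lt_ji.
    by rewrite mulmx0 dot0r subr0 normr0 normA0 mulr0.
  + rewrite -eq_ij (actE _ _ (leqnn i)).
    have [_ [_ _ _ e4]] := column_error i; apply: le_trans e4 _.
    have [_ _ _ _ mual] := small_unit HS.
    have := ler_wpM2l (ltW eta0) (la_norm_prod HS (col i Q) (z i i)).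
    have := ler_wpM2l (ltW eta0)
      (ler_wpM2r (normA_ge0 A (z i i)) (normA_column i)).
    have := mulr_ge0 (ltW eta0) (normA_ge0 A (z i i)).
    by rewrite -[15 * _ * al]mulrA mual; lra.
- move=> i; case: (column_error i) => -[[z0 q0 p0 r0]|H] _; last by right.
  left=> j; have [lt_ij|lt_ji|/val_inj <- //] := ltngtP i j.
    exact: fl_dot0 p0 (mgs_offdiag HR lt_ij).
  by have [] := low i j lt_ji.
- by move=> i; have [_ [_ _ e3 _]] := column_error i; apply: e3 => //; exact: zmu.
- by move=> i; have [_ []] := column_error i.
- move=> i j lt_ij; rewrite (actE _ _ (ltnW lt_ij)).
  have := fl_sum_l2 (ltW u0) (fl_td HS) double_mu_le1 (mgs_offdiag HR lt_ij).
  rewrite -!norm2E (@eq_node_sums _ td _ (fun k => P k i * z j i k 0)) //.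
  by move=> k; rewrite mxE.
- by move=> j; rewrite (actE _ _ (leqnn j)); have [_ []] := column_error j.
- move=> i j; rewrite /active; case: ifP => [/zmu //|_].
  by rewrite norm20 normA0 mulr0.
Qed.

End Columns.

(** No column depends on later ones, so the leading columns form a run of their own; needed for the
    induction in [normA_Q_le]. *)
Lemma mgs_restrict n k (f : 'I_k -> 'I_n) (z : 'I_n -> nat -> 'cV[R]_m)
    (Z X P Q : 'M[R]_(m, n)) (Rh : 'M[R]_n) :
  (forall i, f i = i :> nat) -> mgs_ha_col u td tm A Z z X P Q Rh ->
  mgs_ha_col u td tm A (colsub f Z) (z \o f) (colsub f X) (colsub f P)
    (colsub f Q) (mxsub f f Rh).
Proof.
move=> fE HR.
have colE (M : 'M[R]_(m, n)) j : col j (colsub f M) = col (f j) M.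
  by apply/matrixP => a b; rewrite !mxE.
split=> [j|i j ij|i j ij|j|j|j|j|i j ij]; rewrite ?colE ?mxE /=.
- exact: mgs_init HR (f j).
- by rewrite -(fE i); apply: (mgs_offdiag HR); rewrite !fE.
- by rewrite -(fE i); apply: (mgs_update HR); rewrite !fE.
- by rewrite -(fE j); exact: (mgs_mulA HR).
- by rewrite -(fE j); exact: (mgs_diag HR).
- by rewrite -(fE j); exact: (mgs_q HR).
- exact: (mgs_p HR).
- by apply: (mgs_lower HR); rewrite !fE.
Qed.

(* Induction on the number of columns: one more column raises the norm of
   [A^(1/2) Q] by little enough for the a priori analysis to apply. *)
Lemma normA_Q_le n (z : 'I_n -> nat -> 'cV[R]_m) (Z X P Q : 'M[R]_(m, n))
    (Rh : 'M[R]_n) (sg S : R) :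
  mgs_ha_col u td tm A Z z X P Q Rh ->
  (forall v, normA A (Z *m v) <= S * norm2 v) ->
  (forall v, sg * norm2 v <= normA A (Z *m v)) ->
  0 < sg -> sg <= S -> 100 * 100 * 100 * (Num.sqrt m%:R * eta * S) <= sg ->
  (n <= m)%N -> forall v, normA A (Q *m v) <= 2 * norm2 v.
Proof.
have l0 := fl_la_gt0 HS; have psd := psdA HS.
elim: n z Z X P Q Rh => [|n IH] z Z X P Q Rh HR Zup Zlo sg0 sgS sm nm v.
  rewrite mulmx_sum_cols big_ord0 normA0.
  by rewrite mulr_ge0 ?norm2_ge0.
pose w := widen_ord (leqnSn n).
(* The induction hypothesis gives 2 and the last column at most 11/10. *)
have Q4 v' : normA A (Q *m v') <= 4 * norm2 v'.
  (* Extending [x] by a zero entry transfers the bounds on [Z] to its leading columns. *)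
  have restr (M : 'M[R]_(m, n.+1)) (x : 'cV_n) :
      exists2 x' : 'cV_n.+1, norm2 x' = norm2 x & colsub w M *m x = M *m x'.
    exists (\col_i oapp (fun k => x k 0) 0 (insub (val i))).
      rewrite /norm2 /dot big_ord_recr /= !mxE insubF ?ltnn //= mulr0 addr0.
      congr Num.sqrt; apply: eq_bigr => k _; rewrite !mxE /=.
      by rewrite insubT //= => lt_kn; congr (x _ _ * x _ _); apply: val_inj.
    rewrite !mulmx_sum_cols big_ord_recr /= !mxE insubF ?ltnn //= scale0r addr0.
    apply: eq_bigr => k _; rewrite !mxE /= insubT //= => lt_kn.
    congr (x _ _ *: _); first exact: val_inj.
    by apply/matrixP => a b; rewrite !mxE.
  have IHw := IH _ _ _ _ _ _ (mgs_restrict (f := w) (fun i => erefl) HR) _ _ sg0 sgS sm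
    (ltnW nm).
  rewrite mulmx_sum_cols big_ord_recr /=.
  apply: le_trans (ler_normAD (fl_sym HS) psd _ _) _.
  have -> : \sum_(i < n) v' (widen_ord (leqnSn n) i) 0 *: col (widen_ord (leqnSn n) i) Q
      = colsub w Q *m (\col_i v' (w i) 0).
    rewrite mulmx_sum_cols; apply: eq_bigr => k _; rewrite mxE; congr (_ *: _).
    by apply/matrixP => a b; rewrite !mxE.
  have vw : norm2 (\col_i v' (w i) 0) <= norm2 v'.
    rewrite /norm2 ler_wsqrtr // /dot big_ord_recr /= -[leLHS]addr0 lerD //.
      by rewrite le_eqVlt; apply/orP; left; apply/eqP; apply: eq_bigr => k _; rewrite !mxE.
    by rewrite -expr2 sqr_ge0.
  have H1 : normA A (colsub w Q *m (\col_i v' (w i) 0)) <= 2 * norm2 v'.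
    apply: le_trans (IHw _ _ _) _ => [x|x|].
    - by have [x' <- ->] := restr Z x.
    - by have [x' <- ->] := restr Z x.
    - by rewrite ler_wpM2l.
  have H2 : normA A (v' ord_max 0 *: col ord_max Q) <= norm2 v' * (11 / 10).
    rewrite normAZ // ler_pM ?normA_ge0 ?(normA_column HR) //.
    by rewrite norm2E; exact: (ler_norm_l2 (fun k => v' k 0)).
  have := norm2_ge0 v'; lra.
pose sl := Num.sqrt la; have sl0 : 0 < sl by rewrite sqrtr_gt0.
have sl2 : sl ^+ 2 = la by rewrite sqr_sqrtr // ltW.
(* Coercivity alone allows [mu = sl^-1] and, by [Q4], [y = 4 * sl^-1]; hence the 4 in [err_ymu]. *)
have mu0 : 0 <= sl^-1 by rewrite invr_ge0 ltW.
have y0 : 0 <= 4 * sl^-1 by rewrite mulr_ge0.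
have norm_le x : norm2 x <= sl^-1 * normA A x.
  by rewrite mulrC ler_pdivlMr // mulrC; exact: (sqrt_la_norm HS).
have zmu (i j : 'I_n.+1) : (i <= j)%N -> norm2 (z j i) <= sl^-1 * normA A (z j i).
  by move=> _; exact: norm_le.
have mula : sl^-1 ^+ 2 * la <= 1 by rewrite -sl2 -exprMn mulVf ?gt_eqF // expr1n.
have Qy : opbound Q (4 * sl^-1).
  move=> x; apply: le_trans (norm_le _) _; rewrite mulrAC mulrC.
  by rewrite ler_wpM2r.
have ymu : 4 * sl^-1 * sl^-1 * la <= 4.
  have -> : 4 * sl^-1 * sl^-1 * la = 4 * (sl^-1 ^+ 2 * la) by ring.
  lra.
have HE := run_errors HR zmu mu0 mula Qy y0 ymu Zup Zlo sg0 sgS sm nm.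
have loss := loss_of_orthogonality HS HE v.
have [t0 _ _ _] := tau_bounds HS.
have phit := phi_tau HS HE.
(* With 3 here the squared energy of [Q *m v] is at most [(1 + 3) * norm2 v ^+ 2], which restores
   the constant 2. *)
have c3 : 720 * (m%:R * u * Num.sqrt m%:R * al * (4 * sl^-1) * sl^-1) * (S / sg) <= 3.
  rewrite mulrA ler_pdivrMr //.
  have := ler_wpM2r (ltW (lt_le_trans sg0 sgS)) phit; lra.
have : normA A (Q *m v) ^+ 2 <= (2 * norm2 v) ^+ 2.
  rewrite sqr_normA // dotC dot_mulmx dotC.
  have -> : Q^T *m (A *m (Q *m v)) = v + (Q^T *m A *m Q - 1%:M) *m v.
    by rewrite mulmxBl mul1mx addrC subrK !mulmxA.
  rewrite dotDr -sqr_norm2 exprMn.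
  have := le_trans (ler_norm _) (cauchy_dot v ((Q^T *m A *m Q - 1%:M) *m v)).
  have := ler_wpM2l (norm2_ge0 v) (le_trans loss (ler_wpM2r (norm2_ge0 v) c3)).
  by rewrite expr2; lra.
by apply: ler_sqr_abs; rewrite mulr_ge0 ?norm2_ge0.
Qed.

End Run.

(** * The bounds with the condition numbers *)

Lemma powR_3_2 (R : realType) (m : nat) : (0 < m)%N ->
  m%:R `^ (3 / 2) = m%:R * Num.sqrt m%:R :> R.
Proof.
move=> m0; have -> : 3 / 2 = 1 + 2^-1 :> R by field.
rewrite powRD; last by apply/implyP => _; rewrite pnatr_eq0 -lt0n.
by rewrite powRr1 // powR12_sqrt.
Qed.

Lemma ler_div_1B (R : realType) (a b : R) : a <= b -> b < 1 -> a / (1 - a) <= b / (1 - b).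
Proof.
move=> ab b1; rewrite ler_pdivrMr ?subr_gt0 ?(le_lt_trans ab) //.
rewrite mulrAC ler_pdivlMr ?subr_gt0 //; lra.
Qed.

Theorem mainTheorem1 (R : realType) :
  exists C1 C2 : R, 0 < C1 /\ 0 < C2 /\
  forall (m n : nat) (A : 'M[R]_m) (Ahalf : 'M[R]_m) (Z : 'M[R]_(m, n))
    (u : R) (td tm : sum_order 'I_m)
    (z : 'I_n -> nat -> 'cV[R]_m) (X P Q : 'M[R]_(m, n)) (Rh : 'M[R]_n),
  (1 <= n)%N -> (n <= m)%N ->
  spd A -> spd_sqrt A Ahalf -> \rank Z = n ->
  0 < u -> complete_order td -> complete_order tm ->
  mgs_ha_col u td tm A Z z X P Q Rh ->
  C2 * (m%:R `^ (3 / 2)) * u * kappa A * kappa (Ahalf *m Z) < 1 ->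
  let a := C1 * (m%:R `^ (3 / 2)) * u * specnorm A * specnorm Q
             * mgs_mu A z * kappa (Ahalf *m Z) in
  let b := C2 * (m%:R `^ (3 / 2)) * u * kappa A * kappa (Ahalf *m Z) in
  specnorm (Q^T *m A *m Q - 1%:M) <= a / (1 - a) /\
  a / (1 - a) <= b / (1 - b).
Proof.
(* [C1] is the constant of [loss_of_orthogonality]. [C2] is generous: it must exceed [2 * C1] for
   [a <= b] and provide the smallness in [fl_setting] and [mgs_errors]. *)
exists 720, (100 * 100 * 100); split; first by []; split; first by rewrite !mulr_gt0.
move=> m n A Ahalf Z u td tm z X P Q Rh n0 nm spdA [spdH HH] rkZ u0 tdP tmP HR.
have m0 : (0 < m)%N := leq_trans n0 nm.
have [symA posA] := spdA; have [symH posH] := spdH.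
have [la [SA [l0 kA coerA ASA]]] := spd_kappaP m0 spdA.
have psdA x : 0 <= dot x (A *m x).
  by apply: le_trans (coerA x); rewrite mulr_ge0 ?sqr_ge0 // ltW.
have HnormA x : norm2 (Ahalf *m x) = normA A x.
  by rewrite /norm2 /normA dot_mulmx symH mulmxA HH dotC.
have Zinj (v : 'cV_n) : v != 0 -> Z *m v != 0.
  move=> v0; apply: contraNneq v0 => Zv0.
  have Zt : row_free Z^T by rewrite /row_free mxrank_tr rkZ.
  have := mulmx_free_eq0 v^T Zt; rewrite -trmx_mul Zv0 trmx0 eqxx => /esym/eqP v0.
  by rewrite -[v]trmxK v0 trmx0.
have Minj (v : 'cV_n) : v != 0 -> Ahalf *m Z *m v != 0.
  move=> /Zinj /posA; rewrite -(sqr_normA psdA) -HnormA mulmxA => H.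
  by apply: contraTneq H => ->; rewrite norm20 expr0n ltxx.
have [sg [S [sg0 sgS kM Mlo Mup]]] := kappaP n0 Minj.
have Zup v : normA A (Z *m v) <= S * norm2 v by rewrite -HnormA mulmxA.
have Zlo v : sg * norm2 v <= normA A (Z *m v) by rewrite -HnormA mulmxA.
have S0 : 0 < S := lt_le_trans sg0 sgS.
pose h := Num.sqrt (m%:R : R).
have h0 : 0 <= h by exact: sqrtr_ge0.
rewrite (powR_3_2 _ m0) kA kM -/h.
set al := specnorm A.
have Aal : opbound A al := specnormP A m0.
have alSA : al <= SA := specnorm_le m0 ASA.
have la_al : la <= al.
  have := coerA (delta_mx (Ordinal m0) 0).
  rewrite norm2_delta expr1n mulr1 => /le_trans; apply.
  apply: le_trans (ler_norm _) _; apply: le_trans (cauchy_dot _ _) _.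
  by rewrite norm2_delta mul1r (le_trans (Aal _)) // norm2_delta mulr1.
have al0 : 0 < al := lt_le_trans l0 la_al.
move=> small a b.
pose eta := m%:R * u * (al / la).
have mhu0 : 0 <= m%:R * h * u / la by rewrite !mulr_ge0 ?invr_ge0 // ltW.
have small_sg : 100 * 100 * 100 * (h * eta * S) <= sg.
  have : 100 * 100 * 100 * (m%:R * h) * u * (SA / la) * S < sg.
    by move: small; rewrite mulrA ltr_pdivrMr // mul1r.
  move=> /ltW; apply: le_trans.
  have c0 : 0 <= 100 * 100 * 100 * (m%:R * h * u / la) * S.
    by apply: mulr_ge0; [apply: mulr_ge0 mhu0; rewrite !mulr_ge0 | exact: ltW].
  have := ler_wpM2l c0 alSA; rewrite /eta; lra.
have small1 : 100 * 100 * 100 * (h * eta) <= 1.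
  rewrite -(ler_pM2r S0) mul1r -!mulrA; apply: le_trans sgS.
  by move: small_sg; rewrite -!mulrA.
have HS : fl_setting A al la u eta td tm by [].
have Q2 := normA_Q_le HS HR Zup Zlo sg0 sgS small_sg nm.
pose sl := Num.sqrt la; have sl0 : 0 < sl by rewrite sqrtr_gt0.
have sl2 : sl ^+ 2 = la by rewrite sqr_sqrtr // ltW.
have norm_le x : norm2 x <= sl^-1 * normA A x.
  by rewrite mulrC ler_pdivlMr // mulrC; exact: (sqrt_la_norm HS).
have Qy : opbound Q (specnorm Q) := specnormP Q n0.
have y0 : 0 <= specnorm Q := specnorm_ge0 Q n0.
have y2 : specnorm Q <= 2 * sl^-1.
  apply: specnorm_le n0 _ => x; apply: le_trans (norm_le _) _.
  have -> : 2 * sl^-1 * norm2 x = sl^-1 * (2 * norm2 x) by ring.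
  by rewrite ler_wpM2l // invr_ge0 ltW.
have mu0 : 0 <= mgs_mu A z by exact: bigmax_ge_id.
have mule : mgs_mu A z <= sl^-1.
  have isl0 : 0 <= sl^-1 by rewrite invr_ge0 ltW.
  apply: bigmax_le => // j _; apply: bigmax_le => // i _.
  (* A zero vector contributes the ratio 0 to the maximum, as [0^-1 = 0]. *)
  have [nA0|nA_neq0] := eqVneq (normA A (z j i)) 0; first by rewrite nA0 invr0 mulr0.
  by rewrite ler_pdivrMr ?norm_le // lt_def nA_neq0 normA_ge0.
have zmu (i j : 'I_n) : (i <= j)%N -> norm2 (z j i) <= mgs_mu A z * normA A (z j i).
  move=> ij.
  have [nA0|nA_neq0] := eqVneq (normA A (z j i)) 0.
    by have := norm_le (z j i); rewrite nA0 !mulr0.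
  rewrite -ler_pdivrMr; last by rewrite lt_def nA_neq0 normA_ge0.
  apply: le_trans (le_bigmax 0 _ j).
  exact: (le_bigmax 0 (fun k : 'I_j.+1 => norm2 (z j k) / normA A (z j k))
    (Ordinal (ij : (i < j.+1)%N))).
have isl : sl^-1 * sl^-1 * la = 1 by rewrite -sl2; field; rewrite gt_eqF.
have ymu_le : specnorm Q * mgs_mu A z * la <= 2.
  have := ler_wpM2r (ltW l0) (ler_pM y0 mu0 y2 mule).
  have -> : 2 * sl^-1 * sl^-1 * la = 2 * (sl^-1 * sl^-1 * la) by ring.
  by rewrite isl mulr1.
have mula : mgs_mu A z ^+ 2 * la <= 1.
  by rewrite -isl expr2 ler_wpM2r ?ler_pM // ltW.
have ymu4 : specnorm Q * mgs_mu A z * la <= 4 by apply: le_trans ymu_le _; lra.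
have nm' : (0 < n <= m)%N by rewrite n0.
have HE := run_errors HS HR zmu mu0 mula Qy y0 ymu4 Zup Zlo sg0 sgS small_sg nm'.
have loss := loss_of_orthogonality HS HE.
have aE : a = 720 * (m%:R * u * h * al * specnorm Q * mgs_mu A z) * (S / sg).
  by rewrite /a; ring.
have a0 : 0 <= a.
  rewrite aE; apply: mulr_ge0; last by rewrite divr_ge0 // ltW.
  by apply: mulr_ge0 => //; exact: (phi_ge0 HS HE).
have ab : a <= b.
  rewrite aE /b ler_wpM2r ?divr_ge0 ?(ltW S0) ?(ltW sg0) //.
  (* Inserting [la / la] leaves [specnorm Q * mgs_mu A z * la], at most 2, and [al / la], at most
     [kappa A]. *)
  have -> : 720 * (m%:R * u * h * al * specnorm Q * mgs_mu A z)
    = 720 * (m%:R * h * u / la) * (al * (specnorm Q * mgs_mu A z * la)).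
    by field; rewrite gt_eqF.
  have ymu0 : 0 <= specnorm Q * mgs_mu A z * la.
    by apply: mulr_ge0 (ltW l0); exact: mulr_ge0.
  have := ler_wpM2l mhu0 (ler_pM (ltW al0) ymu0 alSA ymu_le).
  have := mulr_ge0 mhu0 (le_trans (ltW al0) alSA); lra.
have b1 : b < 1 := small.
have a1 : a < 1 := le_lt_trans ab b1.
split; last exact: ler_div_1B.
(* The analysis yields the stronger bound [a], which is at most [a / (1 - a)] as [0 <= a < 1]. *)
apply: (@le_trans _ _ a); first by apply: specnorm_le n0 _; rewrite aE.
by rewrite ler_pdivlMr ?subr_gt0 // mulrBr mulr1 gerBl mulr_ge0.
Qed.
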